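(* Let $\mathbf k$ be a field of characteristic zero and $P$ a truncated operad in complexes of $\mathbf k$-vector spaces. If $P$ is of finite type, then: (1) $\mathrm{Aut}(P)$ is an algebraic matrix group over $\mathbf k$. (2) $\mathbf{Aut}(P)$ is an algebraic affine group scheme over $\mathbf k$, represented by the algebraic matrix group $\mathrm{Aut}(P)$. (3) Homology defines a morphism $\mathbf H:\mathbf{Aut}(P)\to\mathbf{Aut}(HP)$ of algebraic affine group schemes.
   Context: Complexes have differential of degree $-1$, with Koszul signs. A truncated operad is an $n$-truncated operad for some integer $n\ge1$: a finite sequence $P=(P(1),\dots,P(n))$ of complexes with a right $\Sigma_l$-action on each $P(l)$ and composition operations $\circ_i:P(l)\otimes P(m)\to P(l+m-1)$, $1\le i\le l$, satisfying those axioms of the partial composition operations of (non-unital, i.e. pseudo-) operads that make sense for truncated operads. Morphisms are finite sequences of equivariant chain maps commuting with the compositions. $P$ is of finite type if each $P(l)$ is a finite dimensional $\mathbf k$-vector space. $HP$ is the componentwise homology. $\mathrm{Aut}(P)$ is the group of automorphisms of $P$. $\mathbf{Aut}(P)$ is the functor from commutative $\mathbf k$-algebras to groups $R\mapsto\mathbf{Aut}(P)(R)=\mathrm{Aut}_R(P\otimes_{\mathbf k}R)$, where $\mathrm{Aut}_R$ means automorphisms of (truncated) operads in complexes of $R$-modules; thus $\mathbf{Aut}(P)(\mathbf k)=\mathrm{Aut}(P)$. An algebraic matrix group over $\mathbf k$ is a closed subgroup of some $\mathbf{GL}_M(\mathbf k)$ defined by polynomial equations. *)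

(* Defs.v *)
From HB Require Import structures.
From mathcomp Require Import all_boot all_order all_algebra all_fingroup zify.
From mathcomp Require Import generic_quotient ring_quotient boolp mpoly.

Set Implicit Arguments.
Unset Strict Implicit.
Unset Printing Implicit Defensive.

Import GRing.Theory.
Local Open Scope ring_scope.
Local Open Scope quotient_scope.

(* [comAlgType k] only contains nonzero algebras; here the zero algebra is a
   commutative k-algebra too. *)
Record kAlg (k : comPzRingType) := KAlg {
  alg_ring :> comPzRingType;
  alg_str : {rmorphism k -> alg_ring} }.

Record algHom (k : comPzRingType) (A B : kAlg k) := AlgHom {
  alg_fun :> {rmorphism A -> B};
  alg_funE : forall a, alg_fun (alg_str A a) = alg_str B a }.

Definition base_alg (k : comPzRingType) : kAlg k :=
  KAlg (idfun : {rmorphism k -> k}).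

Definition algHom_id (k : comPzRingType) (A : kAlg k) : algHom A A :=
  @AlgHom k A A (idfun : {rmorphism A -> A}) (fun=> erefl).

Lemma algHom_compE (k : comPzRingType) (A B C : kAlg k)
    (g : algHom B C) (f : algHom A B) a :
  (g \o f) (alg_str A a) = alg_str C a.
Proof. by rewrite /= !alg_funE. Qed.

Definition algHom_comp (k : comPzRingType) (A B C : kAlg k)
    (g : algHom B C) (f : algHom A B) : algHom A C :=
  @AlgHom k A C (g \o f : {rmorphism A -> C}) (algHom_compE g f).

Section LinearMaps.
Variables (R : pzRingType) (V W : lmodType R) (f : V -> W).
Hypothesis lf : linear f.

Lemma linD : {morph f : v w / v + w}.
Proof. by move=> v w; have := lf 1 v w; rewrite !scale1r. Qed.

Lemma lin0 : f 0 = 0.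
Proof. by apply: (addrI (f 0)); rewrite -linD !addr0. Qed.

Lemma linZ a v : f (a *: v) = a *: f v.
Proof. by have := lf a v 0; rewrite lin0 !addr0. Qed.

Lemma linN v : f (- v) = - f v.
Proof. by rewrite -scaleN1r linZ scaleN1r. Qed.

Lemma linB : {morph f : v w / v - w}.
Proof. by move=> v w; rewrite linD linN. Qed.

End LinearMaps.

Section Extension.
Variables (k : comPzRingType) (A : kAlg k).

(* The word [:: (v1, r1); ...; (vm, rm)] stands for the sum of the vi (x) ri;
   [tens_eq] is the congruence generated by the relations of V (x)_k A. *)
Inductive tens_eq (V : lmodType k) : seq (V * A) -> seq (V * A) -> Prop :=
| tens_refl s : tens_eq s s
| tens_sym s t : tens_eq s t -> tens_eq t s
| tens_trans s t u : tens_eq s t -> tens_eq t u -> tens_eq s u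
| tens_cat s s' t t' : tens_eq s s' -> tens_eq t t' -> tens_eq (s ++ t) (s' ++ t')
| tens_comm s t : tens_eq (s ++ t) (t ++ s)
| tens_zero : tens_eq [:: (0, 0)] [::]
| tens_addl v w r : tens_eq [:: (v + w, r)] [:: (v, r); (w, r)]
| tens_addr v r s : tens_eq [:: (v, r + s)] [:: (v, r); (v, s)]
| tens_scale a v r : tens_eq [:: (a *: v, r)] [:: (v, alg_str A a * r)].

Section ExtensionModule.
Variable V : lmodType k.

Definition tens_eqb (s t : seq (V * A)) : bool := `[< tens_eq s t >].

Lemma tens_eqb_equiv : equiv_class_of tens_eqb.
Proof.
split=> [s|s t|t s u]; first by apply/asboolP; exact: tens_refl.
  by apply/asboolP/asboolP; exact: tens_sym.
by move=> /asboolP st /asboolP tu; apply/asboolP; exact: tens_trans st tu.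
Qed.
Canonical tens_eqb_equiv_rel := EquivRelPack tens_eqb_equiv.
Canonical tens_eqb_encModRel := defaultEncModRel tens_eqb.

Definition ext := {eq_quot tens_eqb}.
HB.instance Definition _ : EqQuotient (seq (V * A)) tens_eqb ext :=
  EqQuotient.on ext.
HB.instance Definition _ := Choice.on ext.

Definition ext_cls (s : seq (V * A)) : ext := \pi_ext s.

Lemma ext_clsP (s t : seq (V * A)) : ext_cls s = ext_cls t <-> tens_eq s t.
Proof.
split=> [/eqP|st]; first by rewrite piE => /asboolP.
by apply/eqP; rewrite piE; apply/asboolP.
Qed.

Lemma ext_repr (s : seq (V * A)) : tens_eq (repr (ext_cls s)) s.
Proof. by apply/ext_clsP; rewrite /ext_cls reprK. Qed.

Definition tens (v : V) (r : A) : ext := ext_cls [:: (v, r)].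
Definition ext_zero : ext := ext_cls [::].
Definition ext_add (x y : ext) : ext := ext_cls (repr x ++ repr y).
Definition ext_scale (a : A) (x : ext) : ext :=
  ext_cls [seq (u.1, a * u.2) | u <- repr x].

Lemma ext_addE s t : ext_add (ext_cls s) (ext_cls t) = ext_cls (s ++ t).
Proof. by apply/ext_clsP/tens_cat; exact: ext_repr. Qed.

Lemma tens_eq_scale a (s t : seq (V * A)) : tens_eq s t ->
  tens_eq [seq (u.1, a * u.2) | u <- s] [seq (u.1, a * u.2) | u <- t].
Proof.
elim=> {s t}.
- by move=> s; exact: tens_refl.
- by move=> s t _; exact: tens_sym.
- by move=> s t u _ st _; exact: tens_trans.
- by move=> s s' t t' _ ? _ ?; rewrite !map_cat; exact: tens_cat.
- by move=> s t; rewrite !map_cat; exact: tens_comm.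
- by rewrite /= mulr0; exact: tens_zero.
- by move=> v w r; exact: tens_addl.
- by move=> v r s; rewrite /= mulrDr; exact: tens_addr.
- by move=> b v r; rewrite /= mulrCA; exact: tens_scale.
Qed.

Lemma ext_scaleE a s :
  ext_scale a (ext_cls s) = ext_cls [seq (u.1, a * u.2) | u <- s].
Proof. by apply/ext_clsP/tens_eq_scale/ext_repr. Qed.

Lemma ext_clsW (P : ext -> Prop) : (forall s, P (ext_cls s)) -> forall x, P x.
Proof. by move=> Ps; elim/quotW. Qed.

Lemma ext_addA : associative ext_add.
Proof.
elim/ext_clsW=> s; elim/ext_clsW=> t; elim/ext_clsW=> u.
by rewrite !ext_addE catA.
Qed.

Lemma ext_addC : commutative ext_add.
Proof.
elim/ext_clsW=> s; elim/ext_clsW=> t; rewrite !ext_addE.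
by apply/ext_clsP; exact: tens_comm.
Qed.

Lemma ext_add0 : left_id ext_zero ext_add.
Proof. by elim/ext_clsW=> s; rewrite ext_addE. Qed.

HB.instance Definition _ := GRing.isNmodule.Build ext ext_addA ext_addC ext_add0.

Lemma ext_clsD s t : ext_cls s + ext_cls t = ext_cls (s ++ t).
Proof. exact: ext_addE. Qed.

Lemma tens0r r : tens_eq [:: (0 : V, r)] [::].
Proof.
apply: (tens_trans _ (tens_zero V)).
by have := tens_scale 0 (0 : V) r; rewrite scaler0 rmorph0 mul0r.
Qed.

Lemma tensr0 v : tens_eq [:: (v : V, 0)] [::].
Proof.
apply: tens_trans (tens0r 0).
apply: tens_sym.
by have := tens_scale 0 v 0; rewrite scale0r rmorph0 mul0r.
Qed.

Lemma ext_scaleA a b x : ext_scale a (ext_scale b x) = ext_scale (a * b) x.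
Proof.
elim/ext_clsW: x => s; rewrite !ext_scaleE -map_comp; congr ext_cls.
by apply: eq_map => u /=; rewrite mulrA.
Qed.

Lemma ext_scale0 x : ext_scale 0 x = 0.
Proof.
elim/ext_clsW: x => s; rewrite ext_scaleE; apply/ext_clsP.
elim: s => [|u s IHs] /=; first exact: tens_refl.
by rewrite mul0r -cat1s -[X in tens_eq _ X]cat0s; apply: tens_cat IHs; exact: tensr0.
Qed.

Lemma ext_scale1 : left_id 1 ext_scale.
Proof.
elim/ext_clsW=> s; rewrite ext_scaleE; congr ext_cls.
by rewrite -[RHS]map_id; apply: eq_map => -[v r] /=; rewrite mul1r.
Qed.

Lemma ext_scaleDr : right_distributive ext_scale +%R.
Proof.
move=> a; elim/ext_clsW=> s; elim/ext_clsW=> t.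
by rewrite ext_clsD !ext_scaleE ext_clsD map_cat.
Qed.

Lemma ext_scaleDl x : {morph ext_scale^~ x : a b / a + b}.
Proof.
move=> a b; elim/ext_clsW: x => s; rewrite !ext_scaleE ext_clsD.
apply/ext_clsP; elim: s => [|u s IHs] /=; first exact: tens_refl.
rewrite mulrDl.
rewrite -cat1s; apply: (tens_trans (tens_cat (tens_addr _ _ _) IHs)) => /=.
rewrite -cat1s -[X in tens_eq _ X]cat1s; apply: tens_cat (tens_refl _) _.
rewrite -cat1s catA -[X in tens_eq _ (_ ++ X)]cat1s catA.
by apply: tens_cat (tens_comm _ _) (tens_refl _).
Qed.

HB.instance Definition _ := GRing.Nmodule_isLSemiModule.Build A ext
  ext_scaleA ext_scale0 ext_scale1 ext_scaleDr ext_scaleDl.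
HB.instance Definition _ := GRing.LSemiModule_isLmodule.Build A ext.

Lemma tensDl r : {morph tens^~ r : v w / v + w}.
Proof. by move=> v w; rewrite ext_clsD; apply/ext_clsP/tens_addl. Qed.

Lemma tensDr v : {morph tens v : r s / r + s}.
Proof. by move=> r s; rewrite ext_clsD; apply/ext_clsP/tens_addr. Qed.

Lemma tensZl a v r : tens (a *: v) r = tens v (alg_str A a * r).
Proof. by apply/ext_clsP/tens_scale. Qed.

Lemma tensZr a v r : a *: tens v r = tens v (a * r).
Proof. exact: ext_scaleE. Qed.

Lemma ext_clsE s : ext_cls s = \sum_(u <- s) tens u.1 u.2.
Proof.
elim: s => [|[v r] s IHs]; first by rewrite big_nil.
by rewrite big_cons -IHs ext_clsD.
Qed.

Lemma ext_ind (P : ext -> Prop) :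
  P 0 -> (forall v r, P (tens v r)) -> (forall x y, P x -> P y -> P (x + y)) ->
  forall x, P x.
Proof.
move=> P0 Pt PD; elim/ext_clsW=> s; rewrite ext_clsE.
by elim/big_ind: _.
Qed.

Record balanced (M : zmodType) (b : V -> A -> M) : Prop := Balanced {
  balDl : forall v w r, b (v + w) r = b v r + b w r;
  balDr : forall v r s, b v (r + s) = b v r + b v s;
  balZ : forall a v r, b (a *: v) r = b v (alg_str A a * r) }.

Definition ext_lift (M : zmodType) (b : V -> A -> M) (x : ext) : M :=
  \sum_(u <- repr x) b u.1 u.2.

Section Lift.
Variables (M : zmodType) (b : V -> A -> M).
Hypothesis bal : balanced b.

Lemma ext_lift_cls s : ext_lift b (ext_cls s) = \sum_(u <- s) b u.1 u.2.
Proof.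
have b0 : b 0 0 = 0 by apply: (addrI (b 0 0)); rewrite -(balDr bal) !addr0.
suff E s' t : tens_eq s' t ->
    \sum_(u <- s') b u.1 u.2 = \sum_(u <- t) b u.1 u.2 by apply/E/ext_repr.
elim=> {s' t} //.
- by move=> s' t u _ -> _ ->.
- by move=> s1 s1' t t' _ E1 _ E2; rewrite !big_cat /= E1 E2.
- by move=> s1 t; rewrite !big_cat /= addrC.
- by rewrite big_seq1 big_nil.
- by move=> v w r; rewrite !big_cons !big_nil /= !addr0 (balDl bal).
- by move=> v r t; rewrite !big_cons !big_nil /= !addr0 (balDr bal).
- by move=> a v r; rewrite !big_seq1 /= (balZ bal).
Qed.

Lemma ext_liftE v r : ext_lift b (tens v r) = b v r.
Proof. by rewrite ext_lift_cls big_seq1. Qed.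

Lemma ext_liftD : {morph ext_lift b : x y / x + y}.
Proof.
elim/ext_clsW=> s; elim/ext_clsW=> t.
by rewrite ext_clsD !ext_lift_cls big_cat.
Qed.

Lemma ext_lift0 : ext_lift b 0 = 0.
Proof. by rewrite [0]/(ext_cls [::]) ext_lift_cls big_nil. Qed.

End Lift.
End ExtensionModule.

Lemma balanced_tens (V : lmodType k) : balanced (@tens V).
Proof. by split=> *; rewrite ?tensDl ?tensDr ?tensZl. Qed.

Section ExtensionMaps.
Variables V W U : lmodType k.

Definition ext_map (f : V -> W) : ext V -> ext W :=
  ext_lift (fun v r => tens (f v) r).

(* For bilinear c, the bilinear map (v (x) r, w (x) s) |-> c v w (x) r s. *)
Definition ext_map2 (c : V -> W -> U) (x : ext V) (y : ext W) : ext U :=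
  ext_lift (fun v r => ext_lift (fun w s => tens (c v w) (r * s)) y) x.

Section Map.
Variable f : V -> W.
Hypothesis lf : linear f.

Lemma balanced_map : balanced (fun v r => tens (f v) r).
Proof.
by split=> [v w r|v r s|a v r]; rewrite ?linD ?linZ ?tensDl ?tensDr ?tensZl.
Qed.

Lemma ext_mapE v r : ext_map f (tens v r) = tens (f v) r.
Proof. exact: ext_liftE balanced_map _ _. Qed.

Lemma ext_mapD : {morph ext_map f : x y / x + y}.
Proof. exact: ext_liftD balanced_map. Qed.

Lemma ext_map0 : ext_map f 0 = 0.
Proof. exact: ext_lift0 balanced_map. Qed.

Lemma ext_map_linear : linear (ext_map f).
Proof.
move=> a x y; rewrite ext_mapD; congr (_ + _).
elim/ext_ind: x => [|v r|x x' Ex Ex'].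
- by rewrite scaler0 ext_map0 scaler0.
- by rewrite tensZr !ext_mapE tensZr.
- by rewrite scalerDr !ext_mapD Ex Ex' scalerDr.
Qed.

End Map.

Section Map2.
Variable c : V -> W -> U.
Hypotheses (cl : forall w, linear (c^~ w)) (cr : forall v, linear (c v)).

Lemma balanced_map2r v r : balanced (fun w s => tens (c v w) (r * s)).
Proof.
split=> [w w' s|w s s'|a w s].
- by rewrite (linD (cr v)) tensDl.
- by rewrite mulrDr tensDr.
- by rewrite (linZ (cr v)) tensZl mulrCA.
Qed.

Lemma balanced_map2 y :
  balanced (fun v r => ext_lift (fun w s => tens (c v w) (r * s)) y).
Proof.
have B := balanced_map2r.
split=> [v v' r|v r r'|a v r]; elim/ext_ind: y => [|w s|y y' Ey Ey'];
  rewrite ?(ext_lift0 (B _ _)) ?addr0 ?(ext_liftE (B _ _)) //.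
- by rewrite (linD (cl w)) tensDl.
- by rewrite !(ext_liftD (B _ _)) Ey Ey' addrACA.
- by rewrite mulrDl tensDr.
- by rewrite !(ext_liftD (B _ _)) Ey Ey' addrACA.
- by rewrite (linZ (cl w)) tensZl mulrA.
- by rewrite !(ext_liftD (B _ _)) Ey Ey'.
Qed.

Lemma ext_map2E v r w s :
  ext_map2 c (tens v r) (tens w s) = tens (c v w) (r * s).
Proof.
by rewrite /ext_map2 (ext_liftE (balanced_map2 _)) (ext_liftE (balanced_map2r _ _)).
Qed.

Lemma ext_map2Dl y : {morph (ext_map2 c)^~ y : x x' / x + x'}.
Proof. exact: ext_liftD (balanced_map2 y). Qed.

Lemma ext_map20l y : ext_map2 c 0 y = 0.
Proof. exact: ext_lift0 (balanced_map2 y). Qed.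

Lemma ext_map2Dr x : {morph ext_map2 c x : y y' / y + y'}.
Proof.
move=> y y'; elim/ext_ind: x => [|v r|x x' Ex Ex'].
- by rewrite !ext_map20l addr0.
- by rewrite /ext_map2 !(ext_liftE (balanced_map2 _)) (ext_liftD (balanced_map2r _ _)).
- by rewrite !ext_map2Dl Ex Ex' addrACA.
Qed.

Lemma ext_map20r x : ext_map2 c x 0 = 0.
Proof. by apply: (addrI (ext_map2 c x 0)); rewrite -ext_map2Dr !addr0. Qed.

Lemma ext_map2_linl y : linear ((ext_map2 c)^~ y).
Proof.
move=> a x x'; rewrite ext_map2Dl; congr (_ + _).
elim/ext_ind: x => [|v r|x z Ex Ez].
- by rewrite scaler0 ext_map20l scaler0.
- elim/ext_ind: y => [|w s|y z Ey Ez].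
  + by rewrite !ext_map20r scaler0.
  + by rewrite tensZr !ext_map2E tensZr mulrA.
  + by rewrite !ext_map2Dr Ey Ez scalerDr.
- by rewrite scalerDr !ext_map2Dl Ex Ez scalerDr.
Qed.

Lemma ext_map2_linr x : linear (ext_map2 c x).
Proof.
move=> a y y'; rewrite ext_map2Dr; congr (_ + _).
elim/ext_ind: y => [|w s|y z Ey Ez].
- by rewrite scaler0 ext_map20r scaler0.
- elim/ext_ind: x => [|v r|x z Ex Ez].
  + by rewrite !ext_map20l scaler0.
  + by rewrite tensZr !ext_map2E tensZr mulrCA.
  + by rewrite !ext_map2Dl Ex Ez scalerDr.
- by rewrite scalerDr !ext_map2Dr Ey Ez scalerDr.
Qed.

End Map2.
End ExtensionMaps.
End Extension.

Arguments tens {k A V} v r.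

Section ChangeOfAlgebra.
Variables (k : comPzRingType) (A B : kAlg k) (g : algHom A B).

Definition ext_mor (V : lmodType k) : ext A V -> ext B V :=
  ext_lift (fun v r => tens v (g r)).

(* For A-linear f : V (x) A -> W (x) A, the B-linear map f (x)_A B read through
   the isomorphism (V (x)_k A) (x)_A B = V (x)_k B. *)
Definition ext_bc (V W : lmodType k) (f : ext A V -> ext A W) : ext B V -> ext B W :=
  ext_lift (fun v s => s *: ext_mor (f (tens v 1))).

Lemma balanced_mor (V : lmodType k) :
  balanced (fun (v : V) (r : A) => tens v (g r) : ext B V).
Proof.
split=> [v w r|v r s|a v r]; rewrite ?rmorphD ?rmorphM ?alg_funE.
- by rewrite tensDl.
- by rewrite tensDr.
- by rewrite tensZl.
Qed.

Lemma ext_morE (V : lmodType k) (v : V) r : ext_mor (tens v r) = tens v (g r).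
Proof. exact: ext_liftE (@balanced_mor V) _ _. Qed.

Lemma ext_morD (V : lmodType k) : {morph @ext_mor V : x y / x + y}.
Proof. exact: ext_liftD (@balanced_mor V). Qed.

Lemma ext_mor0 (V : lmodType k) : @ext_mor V 0 = 0.
Proof. exact: ext_lift0 (@balanced_mor V). Qed.

Lemma ext_morZ (V : lmodType k) a (x : ext A V) :
  ext_mor (a *: x) = g a *: ext_mor x.
Proof.
elim/ext_ind: x => [|v r|x y Ex Ey].
- by rewrite scaler0 ext_mor0 scaler0.
- by rewrite tensZr !ext_morE tensZr rmorphM.
- by rewrite scalerDr !ext_morD Ex Ey scalerDr.
Qed.

Section BaseChange.
Variables (V W : lmodType k) (f : ext A V -> ext A W).
Hypothesis lf : linear f.

Lemma balanced_bc : balanced (fun (v : V) (s : B) => s *: ext_mor (f (tens v 1))).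
Proof.
split=> [v w s|v s t|a v s].
- by rewrite tensDl (linD lf) ext_morD scalerDr.
- by rewrite scalerDl.
- by rewrite tensZl -tensZr (linZ lf) ext_morZ scalerA alg_funE mulrC.
Qed.

Lemma ext_bcD : {morph ext_bc f : x y / x + y}.
Proof. exact: ext_liftD balanced_bc. Qed.

Lemma ext_bc0 : ext_bc f 0 = 0.
Proof. exact: ext_lift0 balanced_bc. Qed.

Lemma ext_bcE v s : ext_bc f (tens v s) = s *: ext_mor (f (tens v 1)).
Proof. exact: ext_liftE balanced_bc _ _. Qed.

Lemma ext_bc_linear : linear (ext_bc f).
Proof.
move=> a x y; rewrite ext_bcD; congr (_ + _).
elim/ext_ind: x => [|v r|x z Ex Ez].
- by rewrite scaler0 ext_bc0 scaler0.
- by rewrite tensZr !ext_bcE scalerA.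
- by rewrite scalerDr !ext_bcD Ex Ez scalerDr.
Qed.

Lemma ext_bc_mor x : ext_bc f (ext_mor x) = ext_mor (f x).
Proof.
elim/ext_ind: x => [|v r|x y Ex Ey].
- by rewrite (lin0 lf) !ext_mor0 ext_bc0.
- by rewrite ext_morE ext_bcE -ext_morZ -(linZ lf) tensZr mulr1.
- by rewrite (linD lf) !ext_morD ext_bcD Ex Ey.
Qed.

End BaseChange.
End ChangeOfAlgebra.

(* Z-graded complexes of R-modules with differential of degree -1.  The degrees
   of source and target are related by an equation, so that no transport
   between the modules [C i] and [C (i - 1 + 1)] is ever needed. *)
Record complex (R : comPzRingType) := Complex {
  cx_mod :> int -> lmodType R;
  cx_d : forall i j : int, i = j + 1 -> cx_mod i -> cx_mod j;
  cx_d_linear : forall i j (e : i = j + 1), linear (cx_d e);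
  cx_dd : forall i j l (e : i = j + 1) (e' : j = l + 1) x,
    cx_d e' (cx_d e x) = 0 }.

Section Homology.
Variables (R : comPzRingType) (C : complex R).

Lemma deg_pred (i : int) : i = i - 1 + 1.
Proof. by rewrite subrK. Qed.

Lemma cx_dE i j (e e' : i = j + 1) (x : C i) : cx_d e x = cx_d e' x.
Proof. by rewrite (eq_irrelevance e e'). Qed.

Definition is_cycle i : pred (C i) := fun x => cx_d (deg_pred i) x == 0.
Definition is_boundary i (x : C i) : Prop := exists y : C (i + 1), cx_d erefl y = x.

Lemma is_cycleP i (x : C i) :
  is_cycle x <-> forall j (e : i = j + 1), cx_d e x = 0.
Proof.
split=> [/eqP dx j e|dx]; last exact/eqP/dx.
have E : j = i - 1 by rewrite e addrK.
by subst j; rewrite (cx_dE e (deg_pred i)).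
Qed.

Lemma boundary_d i j (e : i = j + 1) (y : C i) : is_boundary (cx_d e y).
Proof. by subst i; exists y. Qed.

Lemma boundary_cycle i (x : C i) : is_boundary x -> is_cycle x.
Proof. by case=> y <-; apply/eqP; exact: cx_dd. Qed.

Lemma boundary0 i : is_boundary (0 : C i).
Proof. by exists 0; rewrite (lin0 (cx_d_linear _)). Qed.

Lemma boundaryD i (x y : C i) : is_boundary x -> is_boundary y -> is_boundary (x + y).
Proof. by case=> x' <- [y' <-]; exists (x' + y'); rewrite (linD (cx_d_linear _)). Qed.

Lemma boundaryZ i a (x : C i) : is_boundary x -> is_boundary (a *: x).
Proof. by case=> x' <-; exists (a *: x'); rewrite (linZ (cx_d_linear _)). Qed.

Lemma boundaryN i (x : C i) : is_boundary x -> is_boundary (- x).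
Proof. by rewrite -scaleN1r; exact: boundaryZ. Qed.

Section Degree.
Variable i : int.

Lemma cycle_submod : submod_closed (@is_cycle i).
Proof.
split=> [|a x y /eqP dx /eqP dy]; apply/eqP.
  exact: lin0 (cx_d_linear _).
by rewrite (linD (cx_d_linear _)) (linZ (cx_d_linear _)) dx dy scaler0 addr0.
Qed.
HB.instance Definition _ :=
  GRing.isSubmodClosed.Build R (C i) (@is_cycle i) cycle_submod.

Record cycles := Cycles { cycles_val :> C i; cyclesP : cycles_val \in @is_cycle i }.
HB.instance Definition _ := [isSub for cycles_val].
HB.instance Definition _ := [Choice of cycles by <:].
HB.instance Definition _ := [SubChoice_isSubLmodule of cycles by <:].

Definition bounding : {pred cycles} := fun z => `[< is_boundary (z : C i) >].

Lemma bounding_zmod : zmod_closed bounding.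
Proof.
split=> [|x y /asboolP Bx /asboolP By]; apply/asboolP; first exact: boundary0.
exact: boundaryD Bx (boundaryN By).
Qed.
HB.instance Definition _ := GRing.isZmodClosed.Build cycles bounding bounding_zmod.

Definition homology := Quotient.quot (bounding : zmodClosed cycles).
HB.instance Definition _ := GRing.Zmodule.on homology.

Definition hclass (z : cycles) : homology := \pi_homology z.

Lemma hclass_eq z z' : hclass z = hclass z' <-> is_boundary (cycles_val (z - z')).
Proof.
split=> [/eqP|B]; last by apply/eqP; rewrite -Quotient.idealrBE; apply/asboolP.
by rewrite -Quotient.idealrBE => /asboolP.
Qed.

Lemma hclassD : {morph hclass : x y / x + y}.
Proof. by move=> x y; rewrite /hclass !piE. Qed.

Lemma hclassW (P : homology -> Prop) : (forall z, P (hclass z)) -> forall x, P x.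
Proof. by move=> Pz; elim/quotW. Qed.

Definition hscale (a : R) (x : homology) : homology := hclass (a *: repr x).

Lemma hscaleE a z : hscale a (hclass z) = hclass (a *: z).
Proof.
apply/hclass_eq; rewrite -scalerBr; apply: boundaryZ.
by apply/hclass_eq; rewrite /hclass reprK.
Qed.

Lemma hscaleA a b x : hscale a (hscale b x) = hscale (a * b) x.
Proof. by elim/hclassW: x => z; rewrite !hscaleE scalerA. Qed.

Lemma hscale1 : left_id 1 hscale.
Proof. by elim/hclassW=> z; rewrite hscaleE scale1r. Qed.

Lemma hscaleDr : right_distributive hscale +%R.
Proof.
move=> a; elim/hclassW=> x; elim/hclassW=> y.
by rewrite -hclassD !hscaleE -hclassD scalerDr.
Qed.

Lemma hscaleDl x : {morph hscale^~ x : a b / a + b}.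
Proof. by move=> a b; elim/hclassW: x => z; rewrite !hscaleE -hclassD scalerDl. Qed.

HB.instance Definition _ := GRing.Zmodule_isLmodule.Build R homology
  hscaleA hscale1 hscaleDr hscaleDl.

(* The class of a cycle; by convention 0 on elements that are not cycles. *)
Definition hcl (x : C i) : homology := hclass (insubd 0 x).

Definition hrep (h : homology) : C i := repr h.

Lemma insub_cycle x : is_cycle x -> cycles_val (insubd 0 x) = x.
Proof. by move=> Zx; exact: (@insubdK _ _ cycles 0 x Zx). Qed.

Lemma hrep_cycle h : is_cycle (hrep h).
Proof. exact: cyclesP. Qed.

Lemma hrepK : cancel hrep hcl.
Proof. by move=> h; rewrite /hcl /hrep valKd /hclass reprK. Qed.

Lemma hcl_eq x y : is_cycle x -> is_cycle y -> (hcl x = hcl y <-> is_boundary (x - y)).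
Proof.
move=> Zx Zy; rewrite hclass_eq.
by rewrite [cycles_val _](raddfB (val : cycles -> C i)) /= !insub_cycle.
Qed.

Lemma hclK x : is_cycle x -> is_boundary (hrep (hcl x) - x).
Proof. by move=> Zx; apply/hcl_eq; rewrite ?hrepK //; exact: hrep_cycle. Qed.

Lemma hclP h : exists2 x, is_cycle x & h = hcl x.
Proof. by exists (hrep h); [exact: hrep_cycle | rewrite hrepK]. Qed.

Lemma hclD x y : is_cycle x -> is_cycle y -> hcl (x + y) = hcl x + hcl y.
Proof.
move=> Zx Zy; rewrite /hcl -hclassD; apply/hclass_eq.
have Zxy : is_cycle (x + y) by have := rpredD (Zx : x \in @is_cycle i) Zy.
rewrite [cycles_val _](raddfB (val : cycles -> C i)) raddfD /= !insub_cycle //.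
by rewrite -opprD subrr; exact: boundary0.
Qed.

Lemma hclZ a x : is_cycle x -> hcl (a *: x) = a *: hcl x.
Proof.
move=> Zx; rewrite /hcl [RHS]hscaleE; apply/hclass_eq.
have Zax : is_cycle (a *: x) by exact: (rpredZ a (Zx : x \in @is_cycle i)).
rewrite -[cycles_val _]/(cycles_val _ - a *: cycles_val _) !insub_cycle //.
by rewrite subrr; exact: boundary0.
Qed.

End Degree.
End Homology.

Arguments hcl {R C i} x.
Arguments hrep {R C i} h.

(* Conventions for the component of index [l : 'I_n]: it is the component of
   arity [l.+1], so the arities are 1, ..., n, and the i-th composition, i = 1,
   ..., l.+1, has index i - 1 : 'I_l.+1.  The composite of arities [l.+1] and
   [m.+1] has arity (l + 1) + (m + 1) - 1, that is, index l + m. *)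

(* The inputs of a o_i b, where b has arity [m.+1], are the inputs q != i of a,
   at position [slot i m q], and the inputs q of b, at position i + q. *)
Definition slot (i m q : nat) : nat := if (q < i)%N then q else (q + m)%N.

(* [u] is the permutation s o_i t: it maps the inputs of (a s) o_i (b t) to
   those of a o_(s i) b, by s on the inputs other than i of the first factor
   and by t on those of the second one. *)
Definition block_perm (l m r : nat) (i : 'I_l.+1)
    (s : 'S_l.+1) (t : 'S_m.+1) (u : 'S_r.+1) : Prop :=
  (forall (q : 'I_l.+1) (x : 'I_r.+1), q != i ->
     x = slot i m q :> nat -> u x = slot (s i) m (s q) :> nat) /\
  (forall (q : 'I_m.+1) (x : 'I_r.+1),
     x = (i + q)%N :> nat -> u x = (s i + t q)%N :> nat).

Lemma slot_inj (i m q q' : nat) : slot i m q = slot i m q' -> q = q'.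
Proof. by rewrite /slot; do 2 case: ltnP => ?; lia. Qed.

Lemma slotP (l m r : nat) (i : 'I_l.+1) (x : 'I_r.+1) : r = (l + m)%N ->
  (exists2 q : 'I_l.+1, q != i & x = slot i m q :> nat) \/
  (exists q : 'I_m.+1, x = (i + q)%N :> nat).
Proof.
move=> er; have := ltn_ord x; have := ltn_ord i => il xr.
have [xi|ix] := ltnP x i.
  have xl : (x < l.+1)%N by lia.
  left; exists (Ordinal xl); last by rewrite /slot /= xi.
  by rewrite -val_eqE /=; lia.
have [xim|imx] := ltnP x (i + m.+1).
  have xm : (x - i < m.+1)%N by lia.
  by right; exists (Ordinal xm) => /=; lia.
have xl : (x - m < l.+1)%N by lia.
left; exists (Ordinal xl); first by rewrite -val_eqE /=; lia.
by rewrite /slot /=; case: ltnP; lia.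
Qed.

Lemma slot_lt (l m : nat) (i q : 'I_l.+1) : (slot i m q < (l + m).+1)%N.
Proof. by have ql := ltn_ord q; rewrite /slot; case: (ltnP q i) => ?; lia. Qed.

Lemma slot_out (i m q q' : nat) : q != i -> (q' < m.+1)%N -> slot i m q <> (i + q')%N.
Proof. by move=> /eqP qi qm; rewrite /slot; case: ltnP => ? ?; lia. Qed.

Lemma block_perm_exists (l m r : nat) (i : 'I_l.+1) (s : 'S_l.+1) (t : 'S_m.+1) :
  r = (l + m)%N -> exists u : 'S_r.+1, block_perm i s t u.
Proof.
move=> er.
pose R (x y : 'I_r.+1) : bool :=
  [exists q : 'I_l.+1, [&& q != i, val x == slot i m q & val y == slot (s i) m (s q)]]
  || [exists q : 'I_m.+1, (val x == i + q)%N && (val y == s i + t q)%N].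
have Rex x : exists y, R x y.
  have [[q qi xq]|[q xq]] := slotP i x er.
    have yr : (slot (s i) m (s q) < r.+1)%N by rewrite er; exact: slot_lt.
    exists (Ordinal yr); apply/orP; left; apply/existsP; exists q.
    by rewrite qi /= xq !eqxx.
  have yr : (s i + t q < r.+1)%N by have := ltn_ord (s i); have := ltn_ord (t q); lia.
  exists (Ordinal yr); apply/orP; right; apply/existsP; exists q.
  by rewrite /= xq !eqxx.
pose f x := xchoose (Rex x).
have fR x : R x (f x) := xchooseP (Rex x).
have f_inj : injective f.
  move=> x x' E; have := fR x; have := fR x'; rewrite -E.
  have sq q : q != i -> (s q != s i :> nat) by rewrite val_eqE (inj_eq perm_inj).
  move=> /orP[/existsP[q /and3P[qi /eqP xq /eqP yq]]|/existsP[q /andP[/eqP xq /eqP yq]]];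
  move=> /orP[/existsP[q' /and3P[q'i /eqP xq' /eqP yq']]|/existsP[q' /andP[/eqP xq' /eqP yq']]];
  apply: val_inj; rewrite /= ?xq ?xq' //=.
  - by move: yq'; rewrite yq => /slot_inj/val_inj/perm_inj ->.
  - by case: (slot_out (sq _ qi) (ltn_ord (t q'))); rewrite -yq -yq'.
  - by case: (slot_out (sq _ q'i) (ltn_ord (t q))); rewrite -yq -yq'.
  - by move: yq'; rewrite yq => /addnI/val_inj/perm_inj ->.
exists (perm f_inj); split=> [q x qi xq|q x xq]; rewrite permE;
  case/orP: (fR x) => [/existsP[q' /and3P[q'i /eqP xq' /eqP ->]]|/existsP[q' /andP[/eqP xq' /eqP ->]]].
- by move: xq'; rewrite /= xq => /slot_inj/val_inj ->.
- by case: (slot_out qi (ltn_ord q')); rewrite -xq.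
- by case: (slot_out q'i (ltn_ord q)); rewrite -xq -xq'.
- by move: xq'; rewrite /= xq => /addnI/val_inj ->.
Qed.

(* Truncated (non-unital) operads in complexes of R-modules.  A chain map out
   of P(l) (x) P(m) is a family of bilinear maps satisfying the Leibniz rule. *)
Record truncOperad (R : comPzRingType) (n : nat) := TruncOperad {
  op_cx :> 'I_n -> complex R;

  op_act : forall {l : 'I_n} {p : int}, 'S_l.+1 -> op_cx l p -> op_cx l p;
  op_act_linear : forall (l : 'I_n) (p : int) (s : 'S_l.+1),
    linear (op_act s : op_cx l p -> op_cx l p);
  op_act_d : forall (l : 'I_n) (p p' : int) (e : p = p' + 1) (s : 'S_l.+1) (x : op_cx l p),
    cx_d e (op_act s x) = op_act s (cx_d e x);
  op_act1 : forall (l : 'I_n) (p : int) (x : op_cx l p), op_act 1%g x = x;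
  (* A right action: [perm] multiplies from left to right, so that [(t * s)%g]
     is the composite x |-> s (t x), and x (s o t) = (x s) t. *)
  op_actM : forall (l : 'I_n) (p : int) (s t : 'S_l.+1) (x : op_cx l p),
    op_act (t * s)%g x = op_act t (op_act s x);

  op_circ : forall {l m r : 'I_n} (i : 'I_l.+1) {p q u : int},
    r = (l + m)%N :> nat -> u = p + q -> op_cx l p -> op_cx m q -> op_cx r u;
  op_circ_linl : forall (l m r : 'I_n) (i : 'I_l.+1) (p q u : int)
      (er : r = (l + m)%N :> nat) (eu : u = p + q) (b : op_cx m q),
    linear (fun a : op_cx l p => op_circ i er eu a b);
  op_circ_linr : forall (l m r : 'I_n) (i : 'I_l.+1) (p q u : int)
      (er : r = (l + m)%N :> nat) (eu : u = p + q) (a : op_cx l p),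
    linear (op_circ i er eu a : op_cx m q -> op_cx r u);
  op_circ_d : forall (l m r : 'I_n) (i : 'I_l.+1) (p p' q q' u u' : int)
      (er : r = (l + m)%N :> nat) (eu : u = p + q)
      (ep : p = p' + 1) (eq : q = q' + 1) (eu' : u = u' + 1)
      (el : u' = p' + q) (er' : u' = p + q') (a : op_cx l p) (b : op_cx m q),
    cx_d eu' (op_circ i er eu a b) =
      op_circ i er el (cx_d ep a) b
      + (-1) ^+ absz p *: op_circ i er er' a (cx_d eq b);

  (* (a o_i b) o_(i+j) c = a o_i (b o_j c) *)
  op_circA : forall (l m h lm mh lmh : 'I_n) (p q w pq qw pqw : int)
      (i : 'I_l.+1) (j : 'I_m.+1) (ij : 'I_lm.+1)
      (e1 : lm = (l + m)%N :> nat) (e2 : lmh = (lm + h)%N :> nat)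
      (e3 : mh = (m + h)%N :> nat) (e4 : lmh = (l + mh)%N :> nat)
      (d1 : pq = p + q) (d2 : pqw = pq + w) (d3 : qw = q + w) (d4 : pqw = p + qw)
      (a : op_cx l p) (b : op_cx m q) (c : op_cx h w),
    ij = (i + j)%N :> nat ->
    op_circ ij e2 d2 (op_circ i e1 d1 a b) c =
      op_circ i e4 d4 a (op_circ j e3 d3 b c);

  (* for i < j, with j' the position of the input j of a in a o_i b:
     (a o_i b) o_j' c = (-1)^(|b| |c|) (a o_j c) o_i b *)
  op_circC : forall (l m h lm lh lmh : 'I_n) (p q w pq pw pqw : int)
      (i j : 'I_l.+1) (j' : 'I_lm.+1) (i' : 'I_lh.+1)
      (e1 : lm = (l + m)%N :> nat) (e2 : lmh = (lm + h)%N :> nat)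
      (e3 : lh = (l + h)%N :> nat) (e4 : lmh = (lh + m)%N :> nat)
      (d1 : pq = p + q) (d2 : pqw = pq + w) (d3 : pw = p + w) (d4 : pqw = pw + q)
      (a : op_cx l p) (b : op_cx m q) (c : op_cx h w),
    (i < j)%N -> j' = (j + m)%N :> nat -> i' = i :> nat ->
    op_circ j' e2 d2 (op_circ i e1 d1 a b) c =
      (-1) ^+ (absz q * absz w) *: op_circ i' e4 d4 (op_circ j e3 d3 a c) b;

  (* (a s) o_i (b t) = (a o_(s i) b) (s o_i t) *)
  op_circ_act : forall (l m r : 'I_n) (i : 'I_l.+1) (p q u : int)
      (er : r = (l + m)%N :> nat) (eu : u = p + q)
      (s : 'S_l.+1) (t : 'S_m.+1) (v : 'S_r.+1) (a : op_cx l p) (b : op_cx m q),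
    block_perm i s t v ->
    op_circ i er eu (op_act s a) (op_act t b) =
      op_act v (op_circ (s i) er eu a b) }.

(* P is of finite type: the total vector space of each P(l) is spanned by
   finitely many homogeneous elements. *)
Definition finite_dim (R : comPzRingType) (V : lmodType R) : Prop :=
  exists s : seq V, forall v,
    exists c : 'I_(size s) -> R, v = \sum_(i < size s) c i *: s`_i.

Definition finite_type (R : comPzRingType) (n : nat) (P : truncOperad R n) : Prop :=
  forall l : 'I_n,
    (forall p, finite_dim (P l p)) /\
    (exists N : nat, forall p, (N < absz p)%N -> forall x : P l p, x = 0).

Record is_operad_mor (R : comPzRingType) (n : nat) (P Q : truncOperad R n)
    (f : forall (l : 'I_n) (p : int), P l p -> Q l p) : Prop := IsOperadMor {
  mor_linear : forall (l : 'I_n) (p : int), linear (f l p);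
  mor_d : forall (l : 'I_n) (p p' : int) (e : p = p' + 1) (x : P l p),
    f l p' (cx_d e x) = cx_d e (f l p x);
  mor_act : forall (l : 'I_n) (p : int) (s : 'S_l.+1) (x : P l p), f l p (op_act s x) = op_act s (f l p x);
  mor_circ : forall (l m r : 'I_n) (i : 'I_l.+1) (p q u : int)
      (er : r = (l + m)%N :> nat) (eu : u = p + q) (a : P l p) (b : P m q),
    f r u (op_circ i er eu a b) = op_circ i er eu (f l p a) (f m q b) }.

Record operad_aut (R : comPzRingType) (n : nat) (P : truncOperad R n) := OperadAut {
  aut_fun :> forall (l : 'I_n) (p : int), P l p -> P l p;
  aut_inv : forall (l : 'I_n) (p : int), P l p -> P l p;
  aut_mor : is_operad_mor aut_fun;
  aut_inv_mor : is_operad_mor aut_inv;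
  aut_funK : forall l p, cancel (@aut_fun l p) (@aut_inv l p);
  aut_invK : forall l p, cancel (@aut_inv l p) (@aut_fun l p) }.

Section AutGroup.
Variables (R : comPzRingType) (n : nat) (P : truncOperad R n).

HB.instance Definition _ := gen_eqMixin (operad_aut P).
HB.instance Definition _ := gen_choiceMixin (operad_aut P).

Lemma aut_eq (f g : operad_aut P) : (forall l p x, f l p x = g l p x) -> f = g.
Proof.
case: f g => f f' mf mf' fK f'K [g g' mg mg' gK g'K] /= fg.
have E : f = g by do 3 (apply: functional_extensionality_dep => ?); exact: fg.
rewrite -{}E {g fg} in mg gK g'K *.
have E : f' = g'.
  apply: functional_extensionality_dep => l; apply: functional_extensionality_dep => p.
  apply: functional_extensionality_dep => x.
  by rewrite -[in RHS](f'K l p x) gK.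
rewrite -{}E {g'} in mg' gK g'K *.
by congr OperadAut; exact: Prop_irrelevance.
Qed.

Lemma id_mor : is_operad_mor (fun l p (x : P l p) => x).
Proof. by split. Qed.

Lemma comp_mor (f g : forall (l : 'I_n) (p : int), P l p -> P l p) :
  is_operad_mor f -> is_operad_mor g -> is_operad_mor (fun l p x => f l p (g l p x)).
Proof.
move=> mf mg; split=> [l p a x y|||] *.
- by rewrite (mor_linear mg) (mor_linear mf).
- by rewrite (mor_d mg) (mor_d mf).
- by rewrite (mor_act mg) (mor_act mf).
- by rewrite (mor_circ mg) (mor_circ mf).
Qed.

Definition aut_one : operad_aut P :=
  OperadAut id_mor id_mor (fun l p => frefl _) (fun l p => frefl _).
Definition aut_V (f : operad_aut P) : operad_aut P :=
  OperadAut (aut_inv_mor f) (aut_mor f) (@aut_invK _ _ _ f) (@aut_funK _ _ _ f).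
Definition aut_mul (f g : operad_aut P) : operad_aut P :=
  OperadAut (comp_mor (aut_mor f) (aut_mor g))
    (comp_mor (aut_inv_mor g) (aut_inv_mor f))
    (fun l p => can_comp (@aut_funK _ _ _ f l p) (@aut_funK _ _ _ g l p))
    (fun l p => can_comp (@aut_invK _ _ _ g l p) (@aut_invK _ _ _ f l p)).

Lemma aut_mulA : associative aut_mul. Proof. by move=> f g h; exact: aut_eq. Qed.
Lemma aut_mul1 : left_id aut_one aut_mul. Proof. by move=> f; exact: aut_eq. Qed.
Lemma aut_mulr1 : right_id aut_one aut_mul. Proof. by move=> f; exact: aut_eq. Qed.
Lemma aut_mulV : left_inverse aut_one aut_V aut_mul.
Proof. by move=> f; apply: aut_eq => l p x; exact: aut_funK. Qed.
Lemma aut_mulrV : right_inverse aut_one aut_V aut_mul.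
Proof. by move=> f; apply: aut_eq => l p x; exact: aut_invK. Qed.

HB.instance Definition _ := isGroup.Build (operad_aut P)
  aut_mulA aut_mul1 aut_mulr1 aut_mulV aut_mulrV.

End AutGroup.

Lemma ext_ext (k : comPzRingType) (A : kAlg k) (V : lmodType k) (M : zmodType)
    (f g : ext A V -> M) :
  {morph f : x y / x + y} -> {morph g : x y / x + y} ->
  (forall v r, f (tens v r) = g (tens v r)) -> f =1 g.
Proof.
move=> fD gD fg; have z0 (h : ext A V -> M) : {morph h : x y / x + y} -> h 0 = 0.
  by move=> hD; apply: (addrI (h 0)); rewrite -hD !addr0.
by elim/ext_ind=> [|//|x y Ex Ey]; rewrite ?z0 // fD gD Ex Ey.
Qed.

Section ExtComplex.
Variables (k : comPzRingType) (A : kAlg k) (C : complex k).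

Lemma ext_dd i j l (e : i = j + 1) (e' : j = l + 1) (x : ext A (C i)) :
  ext_map (cx_d e') (ext_map (cx_d e) x) = 0.
Proof.
have L := cx_d_linear; elim/ext_ind: x => [|v r|x y Ex Ey].
- by rewrite !ext_map0.
- rewrite !ext_mapE // cx_dd; apply/ext_clsP; exact: tens0r.
- by rewrite !ext_mapD // Ex Ey addr0.
Qed.

Definition ext_complex : complex A :=
  @Complex A (fun i => ext A (C i)) (fun i j e => ext_map (cx_d e))
    (fun i j e => ext_map_linear (cx_d_linear e)) ext_dd.

End ExtComplex.

Section ExtOperad.
Variables (k : comPzRingType) (A : kAlg k) (n : nat) (P : truncOperad k n).

Let EC (l : 'I_n) := ext_complex A (P l).

Definition eact (l : 'I_n) (p : int) (s : 'S_l.+1) : EC l p -> EC l p :=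
  ext_map (@op_act _ _ P l p s).
Definition ecirc (l m r : 'I_n) (i : 'I_l.+1) (p q u : int)
    (er : r = (l + m)%N :> nat) (eu : u = p + q) : EC l p -> EC m q -> EC r u :=
  ext_map2 (op_circ i er eu).

Lemma ecircDl l m r i p q u er eu b :
  {morph (fun a => @ecirc l m r i p q u er eu a b) : x y / x + y}.
Proof.
by apply: ext_map2Dl => ?; [exact: op_circ_linl | exact: op_circ_linr].
Qed.
Lemma ecircDr l m r i p q u er eu a :
  {morph @ecirc l m r i p q u er eu a : x y / x + y}.
Proof.
by apply: ext_map2Dr => ?; [exact: op_circ_linl | exact: op_circ_linr].
Qed.
Lemma ecircE l m r i p q u er eu (a : P l p) (b : P m q) (x y : A) :
  @ecirc l m r i p q u er eu (tens a x) (tens b y) = tens (op_circ i er eu a b) (x * y).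
Proof.
by apply: ext_map2E => ?; [exact: op_circ_linl | exact: op_circ_linr].
Qed.
Lemma eactD l p s : {morph @eact l p s : x y / x + y}.
Proof. exact/ext_mapD/op_act_linear. Qed.
Lemma eactE l p s (a : P l p) (x : A) : eact s (tens a x) = tens (op_act s a) x.
Proof. exact/ext_mapE/op_act_linear. Qed.
Lemma edD l p q (e : p = q + 1) : {morph @cx_d _ (EC l) p q e : x y / x + y}.
Proof. exact/ext_mapD/cx_d_linear. Qed.
Lemma edE l p q (e : p = q + 1) (a : P l p) (x : A) :
  @cx_d _ (EC l) p q e (tens a x) = tens (cx_d e a) x.
Proof. exact/ext_mapE/cx_d_linear. Qed.

Lemma tens_sign (V : lmodType k) (v : V) (x : A) j :
  (-1) ^+ j *: tens v x = tens ((-1) ^+ j *: v) x.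
Proof. by rewrite tensZr tensZl rmorphXn rmorphN1. Qed.

Lemma eact_d l p p' (e : p = p' + 1) s x :
  @cx_d _ (EC l) p p' e (eact s x) = eact s (cx_d e x).
Proof.
move: x; apply: ext_ext => [x y|x y|v r].
- by rewrite eactD edD.
- by rewrite edD eactD.
- by rewrite eactE !edE eactE op_act_d.
Qed.

Lemma eact1 l p x : @eact l p 1%g x = x.
Proof.
move: x; apply: ext_ext => [x y|x y|v r] //; first exact: eactD.
by rewrite eactE op_act1.
Qed.

Lemma eactM l p s t x : @eact l p (t * s)%g x = eact t (eact s x).
Proof.
move: x; apply: ext_ext => [x y|x y|v r]; first exact: eactD.
- by rewrite !eactD.
- by rewrite !eactE op_actM.
Qed.

Lemma ecirc_d (l m r : 'I_n) (i : 'I_l.+1) (p p' q q' u u' : int)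
    (er : r = (l + m)%N :> nat) (eu : u = p + q)
    (ep : p = p' + 1) (eq : q = q' + 1) (eu' : u = u' + 1)
    (el : u' = p' + q) (er' : u' = p + q') (a : EC l p) (b : EC m q) :
  cx_d eu' (ecirc i er eu a b) =
    ecirc i er el (cx_d ep a) b + (-1) ^+ absz p *: ecirc i er er' a (cx_d eq b).
Proof.
move: a; apply: ext_ext => [a a'|a a'|a x].
- by rewrite ecircDl edD.
- by rewrite edD !ecircDl scalerDr addrACA.
move: b; apply: ext_ext => [b b'|b b'|b y].
- by rewrite ecircDr edD.
- by rewrite edD !ecircDr scalerDr addrACA.
by rewrite ecircE !edE !ecircE tens_sign -tensDl (op_circ_d i er eu ep eq eu' el er').
Qed.

Lemma ecircA (l m h lm mh lmh : 'I_n) (p q w pq qw pqw : int)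
    (i : 'I_l.+1) (j : 'I_m.+1) (ij : 'I_lm.+1)
    (e1 : lm = (l + m)%N :> nat) (e2 : lmh = (lm + h)%N :> nat)
    (e3 : mh = (m + h)%N :> nat) (e4 : lmh = (l + mh)%N :> nat)
    (d1 : pq = p + q) (d2 : pqw = pq + w) (d3 : qw = q + w) (d4 : pqw = p + qw)
    (a : EC l p) (b : EC m q) (c : EC h w) :
  ij = (i + j)%N :> nat ->
  ecirc ij e2 d2 (ecirc i e1 d1 a b) c = ecirc i e4 d4 a (ecirc j e3 d3 b c).
Proof.
move=> eij; move: a; apply: ext_ext => [a a'|a a'|a x]; rewrite ?ecircDl //.
move: b; apply: ext_ext => [b b'|b b'|b y]; rewrite ?ecircDl ?ecircDr ?ecircDl ?ecircDr //.
move: c; apply: ext_ext => [c c'|c c'|c z]; rewrite ?ecircDr ?ecircDr //.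
by rewrite !ecircE mulrA (op_circA e1 e2 e3 e4 d1 d2 d3 d4 a b c eij).
Qed.

Lemma ecircC (l m h lm lh lmh : 'I_n) (p q w pq pw pqw : int)
    (i j : 'I_l.+1) (j' : 'I_lm.+1) (i' : 'I_lh.+1)
    (e1 : lm = (l + m)%N :> nat) (e2 : lmh = (lm + h)%N :> nat)
    (e3 : lh = (l + h)%N :> nat) (e4 : lmh = (lh + m)%N :> nat)
    (d1 : pq = p + q) (d2 : pqw = pq + w) (d3 : pw = p + w) (d4 : pqw = pw + q)
    (a : EC l p) (b : EC m q) (c : EC h w) :
  (i < j)%N -> j' = (j + m)%N :> nat -> i' = i :> nat ->
  ecirc j' e2 d2 (ecirc i e1 d1 a b) c =
    (-1) ^+ (absz q * absz w) *: ecirc i' e4 d4 (ecirc j e3 d3 a c) b.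
Proof.
move=> ij ej ei; move: a; apply: ext_ext => [a a'|a a'|a x].
- by rewrite !ecircDl.
- by rewrite !ecircDl scalerDr.
move: b; apply: ext_ext => [b b'|b b'|b y].
- by rewrite ecircDr ecircDl.
- by rewrite ecircDr scalerDr.
move: c; apply: ext_ext => [c c'|c c'|c z].
- by rewrite ecircDr.
- by rewrite ecircDr ecircDl scalerDr.
by rewrite !ecircE tens_sign mulrAC (op_circC e1 e2 e3 e4 d1 d2 d3 d4 a b c ij ej ei).
Qed.

Lemma ecirc_act (l m r : 'I_n) (i : 'I_l.+1) (p q u : int)
    (er : r = (l + m)%N :> nat) (eu : u = p + q)
    (s : 'S_l.+1) (t : 'S_m.+1) (v : 'S_r.+1) (a : EC l p) (b : EC m q) :
  block_perm i s t v ->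
  ecirc i er eu (eact s a) (eact t b) = eact v (ecirc (s i) er eu a b).
Proof.
move=> bp; move: a; apply: ext_ext => [a a'|a a'|a x].
- by rewrite eactD ecircDl.
- by rewrite ecircDl eactD.
move: b; apply: ext_ext => [b b'|b b'|b y].
- by rewrite eactD ecircDr.
- by rewrite ecircDr eactD.
by rewrite ecircE !eactE ecircE (op_circ_act er eu a b bp).
Qed.

Definition ext_operad : truncOperad A n :=
  @TruncOperad A n EC eact
    (fun l p s => ext_map_linear (@op_act_linear _ _ P l p s))
    eact_d eact1 eactM ecirc
    (fun l m r i p q u er eu => ext_map2_linl
       (@op_circ_linl _ _ P l m r i p q u er eu)
       (@op_circ_linr _ _ P l m r i p q u er eu))
    (fun l m r i p q u er eu => ext_map2_linr
       (@op_circ_linl _ _ P l m r i p q u er eu)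
       (@op_circ_linr _ _ P l m r i p q u er eu))
    ecirc_d ecircA ecircC ecirc_act.

End ExtOperad.

Section HomologyMap.
Variables (R : comPzRingType) (C D : complex R) (i j : int) (f : C i -> D j).
Hypotheses (lf : linear f) (fZ : forall x, is_cycle x -> is_cycle (f x)).
Hypothesis fB : forall x, is_boundary x -> is_boundary (f x).

Lemma hmapE x : is_cycle x -> hcl (f (hrep (hcl x))) = hcl (f x).
Proof.
move=> Zx; apply/hcl_eq; [exact/fZ/hrep_cycle | exact: fZ |].
by rewrite -(linB lf); apply/fB/hclK.
Qed.

Lemma hmap_linear : linear (fun h : homology C i => hcl (f (hrep h))).
Proof.
move=> a x y; have [[z Zz ->] [w Zw ->]] := (hclP x, hclP y).
have Zaz : is_cycle (a *: z) by exact: (rpredZ a (Zz : z \in @is_cycle _ _ i)).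
have Zazw : is_cycle (a *: z + w) by exact: (rpredD (Zaz : _ \in @is_cycle _ _ i) Zw).
rewrite -hclZ // -hclD // !hmapE // (linD lf) (linZ lf).
have Zafz : is_cycle (a *: f z) by exact: (rpredZ a (fZ Zz : _ \in @is_cycle _ _ j)).
by rewrite hclD ?hclZ //; exact: fZ.
Qed.

End HomologyMap.

Lemma homology_complex_linear (R : comPzRingType) (C : complex R) (i j : int) :
  linear (fun _ : homology C i => 0 : homology C j).
Proof. by move=> a x y; rewrite scaler0 addr0. Qed.

Definition homology_complex (R : comPzRingType) (C : complex R) : complex R :=
  @Complex R (fun i => homology C i) (fun i j _ => fun=> 0)
    (fun i j _ => @homology_complex_linear R C i j) (fun _ _ _ _ _ _ => erefl).

Section HomologyOperad.
Variables (R : comPzRingType) (n : nat) (P : truncOperad R n).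
Let HC (l : 'I_n) := homology_complex (P l).

Definition hact (l : 'I_n) (p : int) (s : 'S_l.+1) (x : HC l p) : HC l p :=
  hcl (op_act s (hrep x)).
Definition hcirc (l m r : 'I_n) (i : 'I_l.+1) (p q u : int)
    (er : r = (l + m)%N :> nat) (eu : u = p + q) (x : HC l p) (y : HC m q) :
    HC r u :=
  hcl (op_circ i er eu (hrep x) (hrep y)).

Lemma act_cycle (l : 'I_n) p (s : 'S_l.+1) (x : P l p) :
  is_cycle x -> is_cycle (op_act s x).
Proof.
move=> /is_cycleP Zx; apply/is_cycleP => j e.
by rewrite op_act_d Zx (lin0 (op_act_linear s)).
Qed.

Lemma act_boundary (l : 'I_n) p (s : 'S_l.+1) (x : P l p) :
  is_boundary x -> is_boundary (op_act s x).
Proof. by case=> y <-; exists (op_act s y); rewrite op_act_d. Qed.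

Section Circ.
Variables (l m r : 'I_n) (i : 'I_l.+1) (p q u : int).
Variables (er : r = (l + m)%N :> nat) (eu : u = p + q).

Lemma circ_cycle (a : P l p) (b : P m q) :
  is_cycle a -> is_cycle b -> is_cycle (op_circ i er eu a b).
Proof.
move=> /is_cycleP Za /is_cycleP Zb; apply/is_cycleP => u' e.
have el : u' = (p - 1) + q by rewrite addrAC -eu e addrK.
have er' : u' = p + (q - 1) by rewrite addrA -eu e addrK.
rewrite (op_circ_d i er eu (deg_pred p) (deg_pred q) e el er') Za Zb.
rewrite (lin0 (op_circ_linr i er er' a)) scaler0 addr0.
exact: lin0 (op_circ_linl i er el b).
Qed.

Lemma circ_boundaryl (a : P l p) (b : P m q) :
  is_boundary a -> is_cycle b -> is_boundary (op_circ i er eu a b).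
Proof.
move=> [c <-] /is_cycleP Zb.
have eu1 : u + 1 = (p + 1) + q by rewrite eu addrAC.
have er' : u = (p + 1) + (q - 1) by rewrite eu addrACA subrr addr0.
exists (op_circ i er eu1 c b).
rewrite (op_circ_d i er eu1 erefl (deg_pred q) erefl eu er') Zb.
by rewrite (lin0 (op_circ_linr i er er' c)) scaler0 addr0.
Qed.

Lemma circ_boundaryr (a : P l p) (b : P m q) :
  is_cycle a -> is_boundary b -> is_boundary (op_circ i er eu a b).
Proof.
move=> /is_cycleP Za [c <-].
have eu1 : u + 1 = p + (q + 1) by rewrite eu addrA.
have el : u = (p - 1) + (q + 1) by rewrite eu addrACA addNr addr0.
have B : is_boundary (cx_d (erefl (u + 1)) (op_circ i er eu1 a c)) by exact: boundary_d.
move: B; rewrite (op_circ_d i er eu1 (deg_pred p) erefl erefl el eu) Za.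
rewrite (lin0 (op_circ_linl i er el c)) add0r => /(boundaryZ ((-1) ^+ absz p)).
by rewrite scalerA -exprD addnn -signr_odd odd_double expr0 scale1r.
Qed.

Lemma hcircE (a : P l p) (b : P m q) : is_cycle a -> is_cycle b ->
  hcirc i er eu (hcl a) (hcl b) = hcl (op_circ i er eu a b).
Proof.
move=> Za Zb; rewrite /hcirc.
have Za' := hrep_cycle (hcl a).
rewrite (hmapE (op_circ_linr i er eu _)) //; last first.
- by move=> x; exact: circ_boundaryr.
- by move=> x; exact: circ_cycle.
rewrite (hmapE (f := fun a => op_circ i er eu a b) (op_circ_linl i er eu b)) //.
- by move=> x Zx; exact: circ_cycle.
- by move=> x Bx; exact: circ_boundaryl.
Qed.

Lemma hcirc_linl y : linear (fun x => hcirc i er eu x y).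
Proof.
apply: (hmap_linear (f := fun a => op_circ i er eu a (hrep y))).
- exact: op_circ_linl.
- by move=> x Zx; apply: circ_cycle Zx (hrep_cycle y).
- by move=> x Bx; apply: circ_boundaryl Bx (hrep_cycle y).
Qed.

Lemma hcirc_linr x : linear (hcirc i er eu x).
Proof.
apply: (hmap_linear (f := op_circ i er eu (hrep x))).
- exact: op_circ_linr.
- by move=> y; apply: circ_cycle (hrep_cycle x).
- by move=> y; apply: circ_boundaryr (hrep_cycle x).
Qed.

End Circ.

Lemma hactE (l : 'I_n) p (s : 'S_l.+1) (x : P l p) :
  is_cycle x -> hact s (hcl x) = hcl (op_act s x).
Proof.
apply: (hmapE (f := op_act s)); first exact: op_act_linear.
- by move=> y; exact: act_cycle.
- by move=> y; exact: act_boundary.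
Qed.

Lemma hact_linear (l : 'I_n) p (s : 'S_l.+1) : linear (@hact l p s).
Proof.
apply: (hmap_linear (f := op_act s)); first exact: op_act_linear.
- by move=> y; exact: act_cycle.
- by move=> y; exact: act_boundary.
Qed.

Lemma hact_d (l : 'I_n) p p' (e : p = p' + 1) (s : 'S_l.+1) (x : HC l p) :
  cx_d e (hact s x) = hact s (cx_d e x).
Proof. by rewrite [RHS](lin0 (@hact_linear l p' s)). Qed.

Lemma hact1 (l : 'I_n) p (x : HC l p) : hact 1%g x = x.
Proof. by have [z Zz ->] := hclP x; rewrite hactE // op_act1. Qed.

Lemma hactM (l : 'I_n) p (s t : 'S_l.+1) (x : HC l p) :
  hact (t * s)%g x = hact t (hact s x).
Proof.
have [z Zz ->] := hclP x.
by rewrite !hactE ?op_actM //; exact: act_cycle.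
Qed.

Lemma hcirc_d (l m r : 'I_n) (i : 'I_l.+1) (p p' q q' u u' : int)
    (er : r = (l + m)%N :> nat) (eu : u = p + q)
    (ep : p = p' + 1) (eq : q = q' + 1) (eu' : u = u' + 1)
    (el : u' = p' + q) (er' : u' = p + q') (a : HC l p) (b : HC m q) :
  cx_d eu' (hcirc i er eu a b) =
    hcirc i er el (cx_d ep a) b + (-1) ^+ absz p *: hcirc i er er' a (cx_d eq b).
Proof.
rewrite [in RHS](lin0 (hcirc_linr i er er' a)) scaler0 addr0.
by rewrite [RHS](lin0 (hcirc_linl i er el b)).
Qed.

Lemma hcircA (l m h lm mh lmh : 'I_n) (p q w pq qw pqw : int)
    (i : 'I_l.+1) (j : 'I_m.+1) (ij : 'I_lm.+1)
    (e1 : lm = (l + m)%N :> nat) (e2 : lmh = (lm + h)%N :> nat)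
    (e3 : mh = (m + h)%N :> nat) (e4 : lmh = (l + mh)%N :> nat)
    (d1 : pq = p + q) (d2 : pqw = pq + w) (d3 : qw = q + w) (d4 : pqw = p + qw)
    (a : HC l p) (b : HC m q) (c : HC h w) :
  ij = (i + j)%N :> nat ->
  hcirc ij e2 d2 (hcirc i e1 d1 a b) c = hcirc i e4 d4 a (hcirc j e3 d3 b c).
Proof.
have [x Zx ->] := hclP a; have [y Zy ->] := hclP b; have [z Zz ->] := hclP c.
move=> eij; rewrite !hcircE //; try exact: circ_cycle.
by rewrite (op_circA e1 e2 e3 e4 d1 d2 d3 d4 x y z eij).
Qed.

Lemma hcircC (l m h lm lh lmh : 'I_n) (p q w pq pw pqw : int)
    (i j : 'I_l.+1) (j' : 'I_lm.+1) (i' : 'I_lh.+1)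
    (e1 : lm = (l + m)%N :> nat) (e2 : lmh = (lm + h)%N :> nat)
    (e3 : lh = (l + h)%N :> nat) (e4 : lmh = (lh + m)%N :> nat)
    (d1 : pq = p + q) (d2 : pqw = pq + w) (d3 : pw = p + w) (d4 : pqw = pw + q)
    (a : HC l p) (b : HC m q) (c : HC h w) :
  (i < j)%N -> j' = (j + m)%N :> nat -> i' = i :> nat ->
  hcirc j' e2 d2 (hcirc i e1 d1 a b) c =
    (-1) ^+ (absz q * absz w) *: hcirc i' e4 d4 (hcirc j e3 d3 a c) b.
Proof.
have [x Zx ->] := hclP a; have [y Zy ->] := hclP b; have [z Zz ->] := hclP c.
move=> ij ej ei; rewrite !hcircE //; try exact: circ_cycle.
rewrite -hclZ; last by apply: circ_cycle => //; exact: circ_cycle.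
by rewrite (op_circC e1 e2 e3 e4 d1 d2 d3 d4 x y z ij ej ei).
Qed.

Lemma hcirc_act (l m r : 'I_n) (i : 'I_l.+1) (p q u : int)
    (er : r = (l + m)%N :> nat) (eu : u = p + q)
    (s : 'S_l.+1) (t : 'S_m.+1) (v : 'S_r.+1) (a : HC l p) (b : HC m q) :
  block_perm i s t v ->
  hcirc i er eu (hact s a) (hact t b) = hact v (hcirc (s i) er eu a b).
Proof.
have [x Zx ->] := hclP a; have [y Zy ->] := hclP b.
move=> bp; rewrite (hactE s Zx) (hactE t Zy) !hcircE //; try exact: act_cycle.
rewrite hactE; last exact: circ_cycle.
by rewrite (op_circ_act er eu x y bp).
Qed.

Definition homology_operad : truncOperad R n :=
  @TruncOperad R n HC hact hact_linear hact_d hact1 hactM hcirc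
    hcirc_linl hcirc_linr hcirc_d hcircA hcircC hcirc_act.

End HomologyOperad.

Record groupFunctor (k : comPzRingType) := GroupFunctor {
  gf_obj :> kAlg k -> groupType;
  gf_map : forall A B : kAlg k, algHom A B -> gf_obj A -> gf_obj B;
  gf_mapM : forall A B (g : algHom A B) x y,
    gf_map g (x * y)%g = (gf_map g x * gf_map g y)%g;
  gf_map_id : forall A x, gf_map (algHom_id A) x = x;
  gf_map_comp : forall A B C (g : algHom B C) (f : algHom A B) x,
    gf_map (algHom_comp g f) x = gf_map g (gf_map f x) }.

Record groupFunctorMor (k : comPzRingType) (F G : groupFunctor k) :=
  GroupFunctorMor {
    gfm_fun :> forall A : kAlg k, F A -> G A;
    gfm_M : forall A (x y : F A), gfm_fun (x * y)%g = (gfm_fun x * gfm_fun y)%g;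
    gfm_nat : forall A B (g : algHom A B) (x : F A),
      gfm_fun (gf_map g x) = gf_map g (gfm_fun x) }.

Section AlgebraicGroups.
Variable k : fieldType.

(* [mmap] is not available here: it needs a nonzero target ring. *)
Definition alg_eval (A : kAlg k) (n : nat) (v : 'I_n -> A) (p : {mpoly k[n]}) : A :=
  \sum_(m <- msupp p) alg_str A p@_m * \prod_(i < n) v i ^+ m i.

Definition finitely_generated (A : kAlg k) : Prop :=
  exists (n : nat) (v : 'I_n -> A), forall a, exists p : {mpoly k[n]}, a = alg_eval v p.

(* Algebraic affine group scheme: a functor to groups represented, as a functor
   to sets, by a finitely generated commutative algebra. *)
Definition algebraic_affine_group_scheme (G : groupFunctor k) : Prop :=
  exists A : kAlg k, finitely_generated A /\
    exists u : forall B : kAlg k, algHom A B -> G B,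
      (forall B, bijective (u B)) /\
      (forall (B C : kAlg k) (g : algHom B C) (f : algHom A B),
         u C (algHom_comp g f) = gf_map g (u B f)).

(* The solutions in GL_N(A) of the polynomial equations S over k in the matrix
   entries; the variable of index [mxvec_index i j] is the entry (i, j). *)
Definition GL_zeros (N : nat) (S : seq {mpoly k[N * N]}) (A : kAlg k)
    (g : 'M[A]_N) : Prop :=
  (exists h : 'M[A]_N, g *m h = 1%:M /\ h *m g = 1%:M) /\
  (forall p, p \in S -> alg_eval (mxvec g 0) p = 0).

(* rho is an isomorphism from T onto the subset of GL_N(A) defined by S, which
   is therefore a subgroup. *)
Definition matrix_group_iso (T : groupType) (N : nat) (S : seq {mpoly k[N * N]})
    (A : kAlg k) (rho : T -> 'M[A]_N) : Prop :=
  [/\ injective rho, forall x y, rho (x * y)%g = rho x *m rho y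
    & forall g, GL_zeros S g <-> exists x, rho x = g].

End AlgebraicGroups.

Section AutFunctor.
Variables (k : comPzRingType) (n : nat) (P : truncOperad k n).

Section Map.
Variables (A B : kAlg k) (g : algHom A B).

Lemma mor_ed (l : 'I_n) p p' (e : p = p' + 1) (x : ext_operad A P l p) :
  ext_mor g (cx_d e x : ext A (P l p')) =
    @cx_d _ (ext_operad B P l) p p' e (ext_mor g (x : ext A (P l p))).
Proof.
move: x; apply: ext_ext => [x y|x y|v r]; first by rewrite edD ext_morD.
  by rewrite ext_morD edD.
by rewrite edE !ext_morE edE.
Qed.

Lemma mor_eact (l : 'I_n) p (s : 'S_l.+1) (x : ext A (P l p)) :
  ext_mor g (eact s x) = eact s (ext_mor g x).
Proof.
move: x; apply: ext_ext => [x y|x y|v r]; first by rewrite eactD ext_morD.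
  by rewrite ext_morD eactD.
by rewrite eactE !ext_morE eactE.
Qed.

Lemma mor_ecirc (l m r : 'I_n) (i : 'I_l.+1) (p q u : int)
    (er : r = (l + m)%N :> nat) (eu : u = p + q)
    (a : ext A (P l p)) (b : ext A (P m q)) :
  ext_mor g (ecirc i er eu a b) = ecirc i er eu (ext_mor g a) (ext_mor g b).
Proof.
move: a; apply: ext_ext => [a a'|a a'|a x]; first by rewrite ecircDl ext_morD.
  by rewrite ext_morD ecircDl.
move: b; apply: ext_ext => [b b'|b b'|b y]; first by rewrite ecircDr ext_morD.
  by rewrite ext_morD ecircDr.
by rewrite ecircE !ext_morE ecircE rmorphM.
Qed.

Section Mor.
Variable f : forall (l : 'I_n) (p : int), ext A (P l p) -> ext A (P l p).
Hypothesis mf : @is_operad_mor A n (ext_operad A P) (ext_operad A P) f.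
Let L l p : linear (@f l p) := @mor_linear _ _ _ _ _ mf l p.

Lemma bc_mor : @is_operad_mor B n (ext_operad B P) (ext_operad B P)
  (fun l p => ext_bc g (@f l p)).
Proof.
split.
- by move=> l p; exact: ext_bc_linear.
- move=> l p p' e; apply: (@ext_ext k B (P l p) (ext B (P l p'))) => [x y|x y|v r].
  + by rewrite edD (ext_bcD g (@L l p')).
  + by rewrite (ext_bcD g (@L l p)) edD.
  + rewrite edE (ext_bcE g (@L l p')) (ext_bcE g (@L l p)).
    rewrite -(@edE k A n P) (mor_d mf) mor_ed.
    by rewrite -(linZ (@cx_d_linear _ (ext_operad B P l) _ _ e)).
- move=> l p s; apply: (@ext_ext k B (P l p) (ext B (P l p))) => [x y|x y|v r].
  + by rewrite [op_act _ _]eactD (ext_bcD g (@L l p)).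
  + by rewrite (ext_bcD g (@L l p)) [op_act _ _]eactD.
  + rewrite [op_act _ _]eactE !(ext_bcE g (@L l p)) -(@eactE k A n P) (mor_act mf).
    rewrite [ext_mor g _]mor_eact.
    by rewrite -(linZ (@op_act_linear _ _ (ext_operad B P) l p s)).
- move=> l m r i p q u er eu a b; move: a.
  apply: (@ext_ext k B (P l p) (ext B (P r u))) => [a a'|a a'|a x].
  + by rewrite [op_circ _ _ _ _ _]ecircDl (ext_bcD g (@L r u)).
  + by rewrite (ext_bcD g (@L l p)) [op_circ _ _ _ _ _]ecircDl.
  move: b; apply: (@ext_ext k B (P m q) (ext B (P r u))) => [b b'|b b'|b y].
  + by rewrite [op_circ _ _ _ _ _]ecircDr (ext_bcD g (@L r u)).
  + by rewrite (ext_bcD g (@L m q)) [op_circ _ _ _ _ _]ecircDr.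
  rewrite [op_circ _ _ _ _ _]ecircE.
  rewrite (ext_bcE g (@L r u)) (ext_bcE g (@L l p)) (ext_bcE g (@L m q)).
  have -> : tens (op_circ i er eu a b) 1 = ecirc i er eu (tens a 1) (tens b 1) :> ext A _.
    by rewrite ecircE mulr1.
  rewrite [f _](mor_circ mf i er eu) [ext_mor g _]mor_ecirc.
  rewrite (linZ (@op_circ_linr _ _ (ext_operad B P) l m r i p q u er eu _)).
  rewrite (linZ (@op_circ_linl _ _ (ext_operad B P) l m r i p q u er eu _)).
  by rewrite scalerA mulrC.
Qed.

End Mor.

Lemma bc_can (V : lmodType k) (f h : ext A V -> ext A V) :
  linear f -> linear h -> cancel f h -> cancel (ext_bc g f) (ext_bc g h).
Proof.
move=> lf lh fK; apply: ext_ext => [x y|//|v s].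
  by rewrite !ext_bcD.
rewrite ext_bcE // (linZ (ext_bc_linear g lh)) ext_bc_mor // fK.
by rewrite ext_morE rmorph1 tensZr mulr1.
Qed.

Definition aut_map (f : operad_aut (ext_operad A P)) : operad_aut (ext_operad B P) :=
  @OperadAut B n (ext_operad B P)
    (fun l p => ext_bc g (f l p)) (fun l p => ext_bc g (aut_inv f (l := l) (p := p)))
    (bc_mor (aut_mor f)) (bc_mor (aut_inv_mor f))
    (fun l p => bc_can (@mor_linear _ _ _ _ _ (aut_mor f) l p)
       (@mor_linear _ _ _ _ _ (aut_inv_mor f) l p) (@aut_funK _ _ _ f l p))
    (fun l p => bc_can (@mor_linear _ _ _ _ _ (aut_inv_mor f) l p)
       (@mor_linear _ _ _ _ _ (aut_mor f) l p) (@aut_invK _ _ _ f l p)).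

End Map.

Lemma aut_mapM (A B : kAlg k) (g : algHom A B) (x y : operad_aut (ext_operad A P)) :
  aut_map g (x * y)%g = (aut_map g x * aut_map g y)%g.
Proof.
apply: aut_eq => l p.
have Lx := @mor_linear _ _ _ _ _ (aut_mor x) l p.
have Ly := @mor_linear _ _ _ _ _ (aut_mor y) l p.
have Lxy := @mor_linear _ _ _ _ _ (aut_mor (x * y)%g) l p.
apply: (@ext_ext k B (P l p) (ext B (P l p))) => [v w|v w|v r] /=.
- exact: (ext_bcD g Lxy).
- by rewrite (ext_bcD g Ly) (ext_bcD g Lx).
rewrite (ext_bcE g Lxy) (ext_bcE g Ly) (linZ (ext_bc_linear g Lx)).
by rewrite (ext_bc_mor g Lx).
Qed.

Lemma aut_map_id (A : kAlg k) (x : operad_aut (ext_operad A P)) : aut_map (algHom_id A) x = x.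
Proof.
have mid V : @ext_mor k A A (algHom_id A) V =1 id.
  by apply: ext_ext => [v w|//|v r]; rewrite ?ext_morD ?ext_morE.
apply: aut_eq => l p.
have L := @mor_linear _ _ _ _ _ (aut_mor x) l p.
apply: (@ext_ext k A (P l p) (ext A (P l p))) => [v w|v w|v r] /=.
- exact: (ext_bcD _ L).
- exact: (linD L).
by rewrite (ext_bcE _ L) mid -(linZ L) tensZr mulr1.
Qed.

Lemma aut_map_comp (A B C : kAlg k) (g : algHom B C) (f : algHom A B)
    (x : operad_aut (ext_operad A P)) :
  aut_map (algHom_comp g f) x = aut_map g (aut_map f x).
Proof.
have mc V : ext_mor (algHom_comp g f) (V := V) =1 ext_mor g (V := V) \o ext_mor f (V := V).
  by apply: ext_ext => [v w|v w|v r]; rewrite /= ?ext_morD ?ext_morE.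
apply: aut_eq => l p.
have L := @mor_linear _ _ _ _ _ (aut_mor x) l p.
have L' := ext_bc_linear f L.
apply: (@ext_ext k C (P l p) (ext C (P l p))) => [v w|v w|v r] /=.
- exact: (ext_bcD _ L).
- exact: (ext_bcD _ L').
by rewrite (ext_bcE _ L) (ext_bcE _ L') (ext_bcE _ L) scale1r mc.
Qed.

Definition AutF : groupFunctor k :=
  @GroupFunctor k (fun A => operad_aut (ext_operad A P)) aut_map aut_mapM aut_map_id aut_map_comp.

Lemma ext_map_mor (A : kAlg k)
    (f : forall (l : 'I_n) (p : int), P l p -> P l p) :
  is_operad_mor f ->
  @is_operad_mor A n (ext_operad A P) (ext_operad A P) (fun l p => ext_map (@f l p)).
Proof.
move=> mf; have L l p : linear (@f l p) := @mor_linear _ _ _ _ _ mf l p; split.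
- by move=> l p; exact: ext_map_linear.
- move=> l p p' e; apply: (@ext_ext k A (P l p) (ext A (P l p'))) => [x y|x y|v r].
  + by rewrite edD (ext_mapD (@L l p')).
  + by rewrite (ext_mapD (@L l p)) edD.
  + by rewrite edE (ext_mapE (@L l p')) (ext_mapE (@L l p)) edE (mor_d mf).
- move=> l p s; apply: (@ext_ext k A (P l p) (ext A (P l p))) => [x y|x y|v r].
  + by rewrite [op_act _ _]eactD (ext_mapD (@L l p)).
  + by rewrite (ext_mapD (@L l p)) [op_act _ _]eactD.
  + by rewrite [op_act _ _]eactE !(ext_mapE (@L l p)) [RHS]eactE (mor_act mf).
- move=> l m r i p q u er eu a b; move: a.
  apply: (@ext_ext k A (P l p) (ext A (P r u))) => [a a'|a a'|a x].
  + by rewrite [op_circ _ _ _ _ _]ecircDl (ext_mapD (@L r u)).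
  + by rewrite (ext_mapD (@L l p)) [op_circ _ _ _ _ _]ecircDl.
  move: b; apply: (@ext_ext k A (P m q) (ext A (P r u))) => [b b'|b b'|b y].
  + by rewrite [op_circ _ _ _ _ _]ecircDr (ext_mapD (@L r u)).
  + by rewrite (ext_mapD (@L m q)) [op_circ _ _ _ _ _]ecircDr.
  rewrite [op_circ _ _ _ _ _]ecircE (ext_mapE (@L r u)) (ext_mapE (@L l p)).
  by rewrite (ext_mapE (@L m q)) [RHS]ecircE (mor_circ mf).
Qed.

Lemma ext_map_can (A : kAlg k) (V : lmodType k) (f h : V -> V) :
  linear f -> linear h -> cancel f h ->
  cancel (@ext_map k A V V f) (ext_map h).
Proof.
move=> lf lh fK; apply: ext_ext => [x y|//|v s]; first by rewrite !ext_mapD.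
by rewrite !ext_mapE // fK.
Qed.

(* f |-> f (x) id; for A = k this is the identification of Aut(P) with the
   k-points of [AutF]. *)
Definition aut_ext (A : kAlg k) (f : operad_aut P) : AutF A :=
  @OperadAut A n (ext_operad A P)
    (fun l p => ext_map (f l p)) (fun l p => ext_map (aut_inv f (l := l) (p := p)))
    (ext_map_mor A (aut_mor f)) (ext_map_mor A (aut_inv_mor f))
    (fun l p => ext_map_can (A := A) (@mor_linear _ _ _ _ _ (aut_mor f) l p)
       (@mor_linear _ _ _ _ _ (aut_inv_mor f) l p) (@aut_funK _ _ _ f l p))
    (fun l p => ext_map_can (A := A) (@mor_linear _ _ _ _ _ (aut_inv_mor f) l p)
       (@mor_linear _ _ _ _ _ (aut_mor f) l p) (@aut_invK _ _ _ f l p)).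

(* The Kuenneth map HP (x)_k A -> H(P (x)_k A), [z] (x) r |-> [z (x) r]. *)
Definition kunneth (A : kAlg k) (l : 'I_n) (p : int)
    (x : ext_operad A (homology_operad P) l p) : homology_operad (ext_operad A P) l p :=
  @ext_lift k A (homology (P l) p) (homology (ext_operad A P l) p)
    (fun h r => hcl (tens (hrep h) r : ext_operad A P l p)) x.

Section Kunneth.
Variables (A : kAlg k) (l : 'I_n) (p : int).

Lemma tens_cycle (z : P l p) (r : A) :
  is_cycle z -> is_cycle (tens z r : ext_operad A P l p).
Proof. by move=> /eqP dz; apply/eqP; rewrite edE dz; apply/ext_clsP/tens0r. Qed.

Lemma tens_boundary (z : P l p) (r : A) :
  is_boundary z -> is_boundary (tens z r : ext_operad A P l p).
Proof. by case=> y <-; exists (tens y r); rewrite edE. Qed.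

Lemma kunneth_hcl (z : P l p) (r : A) : is_cycle z ->
  hcl (tens (hrep (hcl z)) r : ext_operad A P l p) = hcl (tens z r : ext_operad A P l p).
Proof.
move=> Zz; apply/hcl_eq; [exact/tens_cycle/hrep_cycle | exact: tens_cycle |].
have -> : (tens (hrep (hcl z)) r : ext_operad A P l p) - tens z r
    = tens (hrep (hcl z) - z) r.
  by apply/eqP; rewrite subr_eq -tensDl subrK.
exact/tens_boundary/hclK.
Qed.

Lemma kunneth_balanced : balanced (fun (h : homology (P l) p) (r : A) =>
  hcl (tens (hrep h) r : ext_operad A P l p)).
Proof.
split=> [x y r|x r s|a x r].
- have [[z Zz ->] [w Zw ->]] := (hclP x, hclP y).
  have Zzw : is_cycle (z + w) by exact: (rpredD (Zz : _ \in @is_cycle _ _ p) Zw).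
  rewrite -hclD // !kunneth_hcl // -hclD; try exact: tens_cycle.
  by rewrite tensDl.
- have [z Zz ->] := hclP x.
  rewrite !kunneth_hcl // -hclD; try exact: tens_cycle.
  by rewrite tensDr.
- have [z Zz ->] := hclP x.
  have Zaz : is_cycle (a *: z) by exact: (rpredZ a (Zz : _ \in @is_cycle _ _ p)).
  by rewrite -hclZ // !kunneth_hcl // tensZl.
Qed.

Lemma kunnethE (z : P l p) (r : A) : is_cycle z ->
  kunneth (tens (hcl z) r : ext_operad A (homology_operad P) l p)
    = hcl (tens z r : ext_operad A P l p).
Proof. by move=> Zz; rewrite /kunneth (ext_liftE kunneth_balanced) kunneth_hcl. Qed.

End Kunneth.

End AutFunctor.

Definition hom_map (R : comPzRingType) (n : nat) (P : truncOperad R n)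
    (f : operad_aut P) (l : 'I_n) (p : int) (x : homology_operad P l p) :
    homology_operad P l p :=
  hcl (f l p (hrep x)).

(* The morphism H sends f to the automorphism H(f) of H(P (x)_k A), transported
   to HP (x)_k A by the Kuenneth isomorphism. *)
Definition induced_on_homology (k : comPzRingType) (n : nat) (P : truncOperad k n)
    (H : groupFunctorMor (AutF P) (AutF (homology_operad P))) : Prop :=
  forall (A : kAlg k) (f : AutF P A) (l : 'I_n) (p : int)
    (x : ext_operad A (homology_operad P) l p),
    kunneth ((H A f : operad_aut _) l p x) = hom_map f (kunneth x).

(* Main.v *)
Require Import Defs.
From HB Require Import structures.
From mathcomp Require Import all_boot all_order all_algebra perm zify.
From mathcomp Require Import generic_quotient ring_quotient boolp.
From mathcomp Require Import mpoly.

Set Implicit Arguments.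
Unset Strict Implicit.
Unset Printing Implicit Defensive.

Import GRing.Theory.
Local Open Scope ring_scope.
Local Open Scope quotient_scope.

(** An automorphism of P is a family of linear maps of finite dimensional spaces
    which respects some linear and bilinear operations.  Gather homogeneous bases
    of all the P(l) into a single basis indexed by ['I_N].  A linear family of
    degree 0 becomes an N x N matrix M commuting with the projections onto the
    homogeneous pieces, and it respects the differential, the actions and the
    compositions exactly when M satisfies polynomial equations, of degree at most
    2, whose coefficients are the structure constants of P.  The inverse of a
    bijective morphism is a morphism, so that Aut(P) is the set of all invertible
    solutions ([aut_mxP]).  The basis of P is also a basis of P (x) A, with the same
    structure constants ([ext_unary_constants], [ext_binary_constants]): the same
    equations cut out Aut_A(P (x) A) in GL_N(A), naturally in the algebra A
    ([matrix_presentation]).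

    A functor of this kind is representable
    ([matrix_group_functor_algebraic]): its A-points are the pairs of mutually
    inverse matrices over A whose first member satisfies the equations, and these
    pairs are the zeros of polynomials in 2 N^2 variables.  The representing
    algebra is the polynomial ring modulo the polynomials that vanish at all such
    pairs over all algebras.

    Homology is finite dimensional again, because independent classes have
    independent representatives ([bounded_dim_homology]); hence the above also
    applies to HP.  Over a field the differential d has a generalized inverse h,
    with d h d = d, and id - h d is a projection onto the cycles.  This projection
    is linear, so it extends to P (x) A, and it makes the Kuenneth map
    HP (x) A -> H(P (x) A) bijective ([kunneth_injective], [kunneth_surjective]).
    The Kuenneth map is a morphism of operads, and conjugation by it turns H(f)
    into an automorphism of HP (x) A.  Multiplicativity, naturality and
    uniqueness of f |-> H(f) then all follow by injectivity of the Kuenneth map. *)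

(** * Evaluation of polynomials and coordinate algebras *)

Section Evaluation.
Variables (k : fieldType) (A : kAlg k) (n : nat) (v : 'I_n -> A).

(** In the zero algebra all maps are equal; in a nonzero one, [alg_eval] is the
    usual evaluation morphism [mmap]. *)
Lemma alg_eval_rmorph :
  exists phi : {rmorphism {mpoly k[n]} -> A},
    [/\ phi =1 alg_eval v, forall c, phi c%:MP = alg_str A c
      & forall i, phi 'X_i = v i].
Proof.
have [A0|A1] := eqVneq (1 : A) 0.
  have az (x y : A) : x = y.
    by rewrite -[x]mul1r -[y]mul1r A0 !mul0r.
  pose z (p : {mpoly k[n]}) : A := 0.
  have zz : zmod_morphism z by move=> x y; exact (az _ _).
  have zm : monoid_morphism z by split=> [|x y]; exact (az _ _).
  pose za := GRing.isZmodMorphism.Build _ _ z zz.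
  pose zb := GRing.isMonoidMorphism.Build _ _ z zm.
  pose phi : {rmorphism {mpoly k[n]} -> A} := HB.pack z za zb.
  by exists phi; split=> [p|c|i]; exact: az.
pose mB := GRing.PzSemiRing_isNonZero.Build A A1.
pose B : comNzRingType := HB.pack (GRing.ComPzRing.sort A) mB.
pose h : {rmorphism k -> B} := alg_str A.
pose phi : {rmorphism {mpoly k[n]} -> B} := mmap h v.
exists phi; split=> [p|c|i]; rewrite /phi /=.
- by [].
- by have -> : mmap h v c%:MP = h c by rewrite mmapC.
- by have -> : mmap h v 'X_i = v i by rewrite mmapX mmap1U.
Qed.

Definition eval_mor : {rmorphism {mpoly k[n]} -> A} := projT1 (cid alg_eval_rmorph).

Lemma eval_morE : eval_mor =1 alg_eval v.
Proof. by rewrite /eval_mor; case: cid => phi []. Qed.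
Lemma eval_morC c : eval_mor c%:MP = alg_str A c.
Proof. by rewrite /eval_mor; case: cid => phi []. Qed.
Lemma eval_morX i : eval_mor 'X_i = v i.
Proof. by rewrite /eval_mor; case: cid => phi []. Qed.

End Evaluation.

Section PolynomialAlgebra.
Variables (k : fieldType) (n : nat).

Definition poly_alg : kAlg k := KAlg (@mpolyC n k : {rmorphism k -> {mpoly k[n]}}).

Definition eval_hom (A : kAlg k) (v : 'I_n -> A) : algHom poly_alg A :=
  @AlgHom k poly_alg A (eval_mor v) (eval_morC v).

Lemma alg_eval_hom (A B : kAlg k) (phi : algHom A B) (v : 'I_n -> A)
    (p : {mpoly k[n]}) :
  phi (alg_eval v p) = alg_eval (phi \o v) p.
Proof.
rewrite /alg_eval rmorph_sum; apply: eq_bigr => m _.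
rewrite rmorphM alg_funE rmorph_prod; congr (_ * _).
by apply: eq_bigr => i _; rewrite rmorphXn.
Qed.

Lemma alg_eval_vars (p : {mpoly k[n]}) :
  alg_eval (A := poly_alg) (fun i => 'X_i) p = p.
Proof.
rewrite [RHS]mpolyE; apply: eq_bigr => m _.
by rewrite [alg_str _ _]/(_%:MP) -mul_mpolyC [in RHS]mpolyXE_id.
Qed.

Lemma poly_homE (A : kAlg k) (phi : algHom poly_alg A) (p : {mpoly k[n]}) :
  phi p = alg_eval (fun i => phi 'X_i) p.
Proof. by rewrite -[p in LHS]alg_eval_vars alg_eval_hom. Qed.

End PolynomialAlgebra.

Lemma algHom_eq (k : comPzRingType) (A B : kAlg k) (f g : algHom A B) :
  f =1 g -> f = g.
Proof.
case: f g => [[f cf] Ef] [[g cg] Eg] /= fg.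
have E : f = g by apply: functional_extensionality_dep.
subst g; have E : cf = cg.
  case: cf cg {Ef Eg fg} => [[a1] [b1]] [[a2] [b2]].
  by rewrite (Prop_irrelevance a1 a2) (Prop_irrelevance b1 b2).
by subst cg; congr AlgHom; exact: Prop_irrelevance.
Qed.

Section CoordinateAlgebra.
Variables (k : fieldType) (n : nat) (Z : forall B : kAlg k, ('I_n -> B) -> Prop).
Variable z0 : 'I_n -> base_alg k.
Hypothesis Zz0 : Z z0.

(** The ideal of a set of points ranging over all algebras at once, instead of the
    ideal generated by given equations: that evaluation at a point of [Z] factors
    through the quotient is then immediate. *)
Definition vanishing : {pred {mpoly k[n]}} := fun p =>
  `[< forall (B : kAlg k) (w : 'I_n -> B), Z w -> eval_mor w p = 0 >].

Lemma vanishingP p :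
  reflect (forall (B : kAlg k) (w : 'I_n -> B), Z w -> eval_mor w p = 0) (p \in vanishing).
Proof. exact: asboolP. Qed.

Lemma vanishing_ideal : idealr_closed vanishing.
Proof.
split=> [||a p q /vanishingP Ip /vanishingP Iq].
- by apply/vanishingP => B w _; rewrite rmorph0.
- by apply/vanishingP => /(_ _ _ Zz0)/eqP; rewrite rmorph1 oner_eq0.
- by apply/vanishingP => B w Zw; rewrite rmorphD rmorphM Ip // Iq // mulr0 addr0.
Qed.
HB.instance Definition _ := isIdealr.Build {mpoly k[n]} vanishing vanishing_ideal.

Definition coord_ring : comNzRingType := Quotient.quot (vanishing : idealr _).
Definition coord_pi : {rmorphism {mpoly k[n]} -> coord_ring} :=
  (\pi_(Quotient.quot (vanishing : idealr _)))%qT.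

Definition coord_alg : kAlg k :=
  @KAlg k coord_ring (coord_pi \o @mpolyC n k : {rmorphism k -> coord_ring}).

Definition coord_proj : algHom (poly_alg k n) coord_alg :=
  @AlgHom k (poly_alg k n) coord_alg coord_pi (fun=> erefl).

Lemma coord_projE p q : (coord_proj p = coord_proj q) <-> p - q \in vanishing.
Proof.
rewrite /coord_proj /= /coord_pi /=; split => [/eqP|pq]; last apply/eqP.
  by rewrite -Quotient.idealrBE.
by rewrite -Quotient.idealrBE.
Qed.

Lemma coord_proj_surj (a : coord_alg) : exists p, a = coord_proj p.
Proof. by exists (repr a); rewrite /= /coord_pi /= reprK. Qed.

Definition coord_point (i : 'I_n) : coord_alg := coord_proj 'X_i.

Lemma coord_fg : finitely_generated coord_alg.
Proof.
exists n, coord_point => a; have [p ->] := coord_proj_surj a.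
by exists p; rewrite poly_homE.
Qed.

(** [coord_point] is the generic point: each point of [Z] is a specialization of
    it, and a unique one by [coord_hom_eq]. *)
Lemma coord_hom_exists (B : kAlg k) (w : 'I_n -> B) : Z w ->
  exists phi : algHom coord_alg B, forall i, phi (coord_point i) = w i.
Proof.
move=> Zw; pose q (a : coord_alg) : B := eval_mor w (projT1 (cid (coord_proj_surj a))).
have qE p : q (coord_proj p) = eval_mor w p.
  rewrite /q; case: cid => p' /= /coord_projE /vanishingP/(_ _ _ Zw)/eqP.
  by rewrite rmorphB subr_eq0 => /eqP.
have qz : zmod_morphism q.
  move=> x y; have [[p ->] [r ->]] := (coord_proj_surj x, coord_proj_surj y).
  by rewrite -rmorphB !qE rmorphB.
have qm : monoid_morphism q.
  split=> [|x y]; first by rewrite -(rmorph1 coord_proj) qE rmorph1.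
  have [[p ->] [r ->]] := (coord_proj_surj x, coord_proj_surj y).
  by rewrite -rmorphM !qE rmorphM.
pose ma := GRing.isZmodMorphism.Build _ _ q qz.
pose mb := GRing.isMonoidMorphism.Build _ _ q qm.
pose phi : {rmorphism coord_alg -> B} := HB.pack q ma mb.
have phiE a : phi (alg_str coord_alg a) = alg_str B a.
  by rewrite -(alg_funE coord_proj) [LHS]qE eval_morC.
exists (@AlgHom k coord_alg B phi phiE) => i.
by rewrite [LHS]qE eval_morX.
Qed.

Lemma coord_hom_eq (B : kAlg k) (f g : algHom coord_alg B) :
  (forall i, f (coord_point i) = g (coord_point i)) -> f = g.
Proof.
move=> fg; apply: algHom_eq => a; have [p ->] := coord_proj_surj a.
rewrite poly_homE !alg_eval_hom; congr (alg_eval _ p).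
exact: functional_extensionality_dep.
Qed.

End CoordinateAlgebra.

(** * Matrix group functors are affine group schemes *)

Lemma mxvec_comp (k : comPzRingType) (A B : kAlg k) (f : algHom A B) (N : nat)
    (g : 'M[A]_N) : f \o mxvec g 0 = mxvec (map_mx f g) 0.
Proof. by apply: functional_extensionality_dep => i; rewrite -map_mxvec mxE. Qed.

Section MatrixGroupScheme.
Variables (k : fieldType) (N : nat) (S : seq {mpoly k[N * N]}).
Notation W := (N * N + N * N)%N.

(** A point of the 2 N^2-dimensional affine space is a pair of matrices. *)
Definition lmat (T : Type) (w : 'I_W -> T) : 'M[T]_N :=
  \matrix_(i, j) w (lshift _ (mxvec_index i j)).
Definition rmat (T : Type) (w : 'I_W -> T) : 'M[T]_N :=
  \matrix_(i, j) w (rshift _ (mxvec_index i j)).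

Lemma lmat_comp (T U : Type) (f : T -> U) w : lmat (f \o w) = map_mx f (lmat w).
Proof. by apply/matrixP => i j; rewrite !mxE. Qed.
Lemma rmat_comp (T U : Type) (f : T -> U) w : rmat (f \o w) = map_mx f (rmat w).
Proof. by apply/matrixP => i j; rewrite !mxE. Qed.

Definition mat_pair (T : Type) (g h : 'M[T]_N) : 'I_W -> T :=
  row_mx (mxvec g) (mxvec h) 0.

Lemma lmat_pair (T : Type) (g h : 'M[T]_N) : lmat (mat_pair g h) = g.
Proof. by apply/matrixP => i j; rewrite mxE /mat_pair row_mxEl mxvecE. Qed.
Lemma rmat_pair (T : Type) (g h : 'M[T]_N) : rmat (mat_pair g h) = h.
Proof. by apply/matrixP => i j; rewrite mxE /mat_pair row_mxEr mxvecE. Qed.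
Lemma mat_pair_eq (T : Type) (v w : 'I_W -> T) :
  lmat v = lmat w -> rmat v = rmat w -> forall i, v i = w i.
Proof.
move=> /matrixP El /matrixP Er i; rewrite -(splitK i).
case: (split i) => j /=; case/mxvec_indexP: j => a b.
  by have := El a b; rewrite !mxE.
by have := Er a b; rewrite !mxE.
Qed.

Definition inverse_pair (B : kAlg k) (w : 'I_W -> B) : Prop :=
  [/\ lmat w *m rmat w = 1%:M, rmat w *m lmat w = 1%:M
    & forall p, p \in S -> alg_eval (mxvec (lmat w) 0) p = 0].

Lemma inverse_pair_comp (B C : kAlg k) (f : algHom B C) (w : 'I_W -> B) :
  inverse_pair w -> inverse_pair (f \o w).
Proof.
move=> [E1 E2 E3]; split=> [||p Sp].
- by rewrite lmat_comp rmat_comp -map_mxM E1 map_mx1.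
- by rewrite lmat_comp rmat_comp -map_mxM E2 map_mx1.
- by rewrite lmat_comp -mxvec_comp -alg_eval_hom E3 // rmorph0.
Qed.

Lemma inverse_pair_zeros (B : kAlg k) (g : 'M[B]_N) :
  GL_zeros S g <-> exists2 w, inverse_pair w & lmat w = g.
Proof.
split=> [[[h [gh hg]] Sg]|[w [wr rw Sw] <-]]; last by split=> //; exists (rmat w).
by exists (mat_pair g h); rewrite /inverse_pair lmat_pair ?rmat_pair.
Qed.

(** Inverses are unique: this is what makes the points of GL_N, defined by a
    mere existence, the same as the points of a closed subset. *)
Lemma inverse_pair_inj (B : kAlg k) (v w : 'I_W -> B) :
  inverse_pair v -> inverse_pair w -> lmat v = lmat w -> v = w.
Proof.
move=> [v1 v2 _] [w1 w2 _] E; apply: functional_extensionality_dep.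
apply: mat_pair_eq => //.
by rewrite -[LHS]mulmx1 -w1 -E mulmxA v2 mul1mx.
Qed.

(** The conditions defining [inverse_pair] are polynomial equations, which lie in
    the ideal of all the points and therefore hold at the generic point. *)
Lemma generic_inverse_pair (z : 'I_W -> base_alg k) (Zz : inverse_pair z) :
  inverse_pair (@coord_point k W inverse_pair z Zz).
Proof.
pose P := coord_proj Zz; pose X : 'I_W -> poly_alg k W := fun i => 'X_i.
have -> : coord_point Zz = P \o X by [].
have eval_vars (B : kAlg k) (w : 'I_W -> B) : eval_hom w \o X = w.
  by apply: functional_extensionality_dep => i; exact: eval_morX.
have PE (Q Q' : 'M[poly_alg k W]_N) :
    (forall (B : kAlg k) (w : 'I_W -> B), inverse_pair w ->
      map_mx (eval_hom w) Q = map_mx (eval_hom w) Q') -> map_mx P Q = map_mx P Q'.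
  move=> QQ; apply/matrixP => i j; rewrite !mxE; apply/coord_projE.
  apply/vanishingP => B w Zw; have /matrixP/(_ i j) := QQ B w Zw.
  by rewrite !mxE rmorphB => E; apply/eqP; rewrite subr_eq0; apply/eqP.
split=> [||p Sp].
- rewrite lmat_comp rmat_comp -map_mxM -[RHS](map_mx1 P); apply: PE => B w [E _ _].
  by rewrite map_mxM -lmat_comp -rmat_comp eval_vars E map_mx1.
- rewrite lmat_comp rmat_comp -map_mxM -[RHS](map_mx1 P); apply: PE => B w [_ E _].
  by rewrite map_mxM -lmat_comp -rmat_comp eval_vars E map_mx1.
- rewrite lmat_comp -mxvec_comp -alg_eval_hom -[RHS](rmorph0 P).
  apply/coord_projE/vanishingP => B w [_ _ E]; rewrite subr0 -[LHS]/(eval_hom w _).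
  by rewrite alg_eval_hom mxvec_comp -lmat_comp eval_vars E.
Qed.

(** The universal element of [G] is the one whose matrix is the first member of the
    generic inverse pair. *)
Lemma matrix_group_functor_algebraic (G : groupFunctor k)
    (eta : forall A : kAlg k, G A -> 'M[A]_N) :
  (forall A : kAlg k, matrix_group_iso S (eta A)) ->
  (forall (A B : kAlg k) (g : algHom A B) (x : G A),
     eta B (gf_map g x) = map_mx g (eta A x)) ->
  algebraic_affine_group_scheme G.
Proof.
move=> iso nat.
have pairG (B : kAlg k) (x : G B) : exists2 w, inverse_pair w & lmat w = eta B x.
  by apply/inverse_pair_zeros; case: (iso B) => _ _ ->; exists x.
(* The unit of G(k) is a point over k, hence the ideal of all points is proper. *)
have [z Zz _] := pairG (base_alg k) 1%g.
pose v := coord_point Zz; have Zv : inverse_pair v := generic_inverse_pair Zz.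
have Gpair (B : kAlg k) (f : algHom (coord_alg Zz) B) :
    exists x : G B, eta B x = lmat (f \o v).
  case: (iso B) => _ _ E; apply/E/inverse_pair_zeros.
  by exists (f \o v); first exact: inverse_pair_comp.
exists (coord_alg Zz); split; first exact: coord_fg.
pose u B f := projT1 (cid (Gpair B f)).
have uE B f : eta B (u B f) = lmat (f \o v) by rewrite /u; case: cid.
exists u; split=> [B|B C g f].
- have [inj_eta _ _] := iso B.
  have surj x : exists f, u B f = x.
    have [w Zw Ew] := pairG B x; have [f Ef] := coord_hom_exists Zz Zw.
    exists f; apply: inj_eta; rewrite uE -Ew; congr lmat.
    exact: functional_extensionality_dep.
  have inj_u : injective (u B).
    move=> f f' /(congr1 (eta B)); rewrite !uE => E.
    apply: coord_hom_eq => i.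
    by have /(congr1 (@^~ i)) := inverse_pair_inj (inverse_pair_comp f Zv)
      (inverse_pair_comp f' Zv) E.
  pose u' x := projT1 (cid (surj x)).
  have u'K : cancel u' (u B) by move=> x; exact: projT2 (cid (surj x)).
  by exists u' => // f; apply: inj_u; rewrite u'K.
- case: (iso C) => inj_eta _ _; apply: inj_eta; rewrite nat.
  by rewrite !uE -lmat_comp.
Qed.

End MatrixGroupScheme.

(** * Finite dimensional vector spaces *)

Lemma lin_sum (R : pzRingType) (V W : lmodType R) (f : V -> W) (I : finType)
    (a : I -> R) (v : I -> V) :
  linear f -> f (\sum_i a i *: v i) = \sum_i a i *: f (v i).
Proof.
move=> lf; rewrite (big_morph f (linD lf) (lin0 lf)).
by apply: eq_bigr => i _; rewrite (linZ lf).
Qed.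

Section Families.
Variables (k : fieldType) (V : lmodType k).

Definition free_family (m : nat) (b : 'I_m -> V) : Prop :=
  forall c : 'rV[k]_m, \sum_i c 0 i *: b i = 0 -> c = 0.

(** Finite dimension in a form that passes to subquotients at once. *)
Definition bounded_dim : Prop :=
  exists m0, forall m (b : 'I_m -> V), free_family b -> (m <= m0)%N.

(** A free family of m vectors has coefficients on a spanning family of d vectors
    which form an m x d matrix of rank m. *)
Lemma finite_dim_bounded : finite_dim V -> bounded_dim.
Proof.
move=> [s sP]; exists (size s) => m b fb.
have [C CE] := choice (fun i => sP (b i)).
pose M : 'M[k]_(m, size s) := \matrix_(i, j) C i j.
suff K0 : kermx M = 0.
  have := rank_leq_col M; have /eqP -> // : row_free M.
  by rewrite -kermx_eq0 K0.
apply/row_matrixP => r; rewrite row0; apply: fb.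
transitivity (\sum_j (row r (kermx M) *m M) 0 j *: s`_j).
  rewrite (eq_bigr (fun i => \sum_j (row r (kermx M) 0 i * M i j) *: s`_j)); last first.
    move=> i _; rewrite CE scaler_sumr; apply: eq_bigr => j _.
    by rewrite scalerA [M i j]mxE.
  rewrite exchange_big; apply: eq_bigr => j _ /=.
  by rewrite -scaler_suml [in RHS]mxE.
by rewrite -row_mul mulmx_ker row0; apply: big1 => j _; rewrite mxE scale0r.
Qed.

(** A free family of maximal size spans: any further vector is dependent on it. *)
Lemma maximal_free_family : bounded_dim ->
  exists m (b : 'I_m -> V), free_family b /\
    forall v, exists c : 'rV[k]_m, v = \sum_i c 0 i *: b i.
Proof.
move=> [m0 bound]; pose F m := `[< exists b : 'I_m -> V, free_family b >].
have F0 : exists m, F m.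
  by exists 0%N; apply/asboolP; exists (fun=> 0) => c _; apply/rowP => -[].
have Fle m : F m -> (m <= m0)%N by move=> /asboolP[b]; exact: bound.
case: (ex_maxnP F0 Fle) => m /asboolP[b fb] maxm; exists m, b; split=> // v.
pose b' (i : 'I_m.+1) : V := oapp b v (unlift ord0 i).
have b'E (c : 'rV_m.+1) : \sum_i c 0 i *: b' i
    = c 0 0 *: v + \sum_(i < m) c 0 (lift ord0 i) *: b i.
  rewrite big_ord_recl /b' unlift_none /=; congr (_ + _).
  by apply: eq_bigr => i _; rewrite liftK.
have nfb' : ~ free_family b'.
  by move=> fb'; have := maxm m.+1 (asboolT (ex_intro _ b' fb')); rewrite ltnn.
have [c cP c_neq0] : exists2 c : 'rV_m.+1, \sum_i c 0 i *: b' i = 0 & c <> 0.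
  apply: contrapT => nc; apply: nfb' => c cb; apply: contrapT => cn0.
  by apply: nc; exists c.
rewrite b'E in cP; have [c0|c0] := eqVneq (c 0 0) 0.
  case: c_neq0; apply/rowP => j; rewrite mxE.
  have [i ->|->] := unliftP ord0 j; last exact: c0.
  have : \row_i c 0 (lift ord0 i) = 0.
    apply: fb; rewrite c0 scale0r add0r in cP; rewrite -[RHS]cP.
    by apply: eq_bigr => l _; rewrite mxE.
  by move=> /rowP/(_ i); rewrite !mxE.
exists (\row_i (- ((c 0 0)^-1 * c 0 (lift ord0 i)))).
apply: (scalerI c0); rewrite scaler_sumr.
move/eqP: cP; rewrite addr_eq0 => /eqP ->; rewrite -sumrN.
apply: eq_bigr => i _.
by rewrite mxE scalerA mulrN mulrA mulfV // mul1r scaleNr.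
Qed.

End Families.

Record coordinates (k : fieldType) (V : lmodType k) := Coordinates {
  crd_dim : nat;
  crd : V -> 'rV[k]_crd_dim;
  crd_inv : 'rV[k]_crd_dim -> V;
  crd_linear : linear crd;
  crd_inv_linear : linear crd_inv;
  crdK : cancel crd crd_inv;
  crd_invK : cancel crd_inv crd }.

Arguments crd {k V} c.
Arguments crd_inv {k V} c.
Arguments crd_linear {k V} c.
Arguments crd_inv_linear {k V} c.
Arguments crdK {k V} c.
Arguments crd_invK {k V} c.

Lemma coordinates_exist (k : fieldType) (V : lmodType k) :
  bounded_dim V -> inhabited (coordinates V).
Proof.
move=> /maximal_free_family[m [b [fb sb]]].
pose g (c : 'rV[k]_m) : V := \sum_i c 0 i *: b i.
have lg : linear g.
  move=> a c d; rewrite /g scaler_sumr -big_split; apply: eq_bigr => i _ /=.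
  by rewrite !mxE scalerDl scalerA.
have [f fE] := choice sb.
have fK : cancel f g by move=> v; rewrite /g -fE.
have g_inj : injective g.
  move=> c d cd; apply/eqP; rewrite -subr_eq0; apply/eqP/fb.
  by rewrite -/(g _) (linB lg) cd subrr.
have lf : linear f by move=> a v w; apply: g_inj; rewrite lg !fK.
by constructor; exact: (Coordinates lf lg fK (fun c => g_inj _ _ (fK (g c)))).
Qed.

(** In coordinates, a pseudo-inverse of the matrix of [f]. *)
Lemma generalized_inverse (k : fieldType) (V W : lmodType k) (f : V -> W) :
  bounded_dim V -> bounded_dim W -> linear f ->
  exists2 h : W -> V, linear h & forall v, f (h (f v)) = f v.
Proof.
move=> /coordinates_exist[cV] /coordinates_exist[cW] lf.
have lF : linear (crd cW \o f \o crd_inv cV).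
  by move=> a x y; rewrite /= (crd_inv_linear cV) lf (crd_linear cW).
pose F := lin1_mx (crd cW \o f \o crd_inv cV).
have FE v : crd cW (f v) = crd cV v *m F.
  pose mF := GRing.isLinear.Build k _ _ _ _ lF.
  pose F' : {linear 'rV_(crd_dim cV) -> 'rV_(crd_dim cW)} :=
    HB.pack (crd cW \o f \o crd_inv cV) mF.
  by rewrite (mul_rV_lin1 F') /= crdK.
exists (fun w => crd_inv cV (crd cW w *m pinvmx F)).
  move=> a x y; rewrite (crd_linear cW) mulmxDl -scalemxAl.
  exact: (crd_inv_linear cV).
move=> v; apply: (can_inj (crdK cW)).
by rewrite FE crd_invK FE mulmxKpV // submxMl.
Qed.

(** * The Kuenneth isomorphism *)

Section Cycles.
Variables (R : comPzRingType) (C : complex R) (i : int).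

Lemma cycle0 : is_cycle (0 : C i).
Proof. exact: boundary_cycle (boundary0 C i). Qed.

Lemma cycleD (x y : C i) : is_cycle x -> is_cycle y -> is_cycle (x + y).
Proof. by move=> Zx Zy; exact: (rpredD (Zx : x \in @is_cycle _ C i) Zy). Qed.

Lemma cycleZ a (x : C i) : is_cycle x -> is_cycle (a *: x).
Proof. by move=> Zx; exact: (rpredZ a (Zx : x \in @is_cycle _ C i)). Qed.

Lemma hcl0 : hcl (0 : C i) = 0.
Proof.
have Z0 := cycle0.
by apply: (addrI (hcl (0 : C i))); rewrite -hclD // !addr0.
Qed.

End Cycles.

(** Representatives of independent classes are independent. *)
Lemma bounded_dim_homology (k : fieldType) (C : complex k) (i : int) :
  bounded_dim (C i) -> bounded_dim (homology C i).
Proof.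
move=> [m0 bound]; exists m0 => m b fb; apply: (bound m (fun j => hrep (b j))).
move=> c c0; apply: fb.
have sumE (r : seq 'I_m) : is_cycle (\sum_(j <- r) c 0 j *: hrep (b j)) /\
    hcl (\sum_(j <- r) c 0 j *: hrep (b j)) = \sum_(j <- r) c 0 j *: b j.
  elim: r => [|j r [Zr Er]].
    by rewrite !big_nil hcl0; split=> //; exact: cycle0.
  have Zcj := cycleZ (c 0 j) (hrep_cycle (b j)).
  rewrite !big_cons; split; first exact: cycleD.
  by rewrite hclD // Er hclZ ?hrepK //; exact: hrep_cycle.
by have [_ <-] := sumE (index_enum 'I_m); rewrite c0 hcl0.
Qed.

Section KunnethLinear.
Variables (k : fieldType) (n : nat) (P : truncOperad k n) (A : kAlg k).
Variables (l : 'I_n) (p : int).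
Local Notation EH := (ext_operad A (homology_operad P) l p).
Local Notation HE := (homology (ext_operad A P l) p).

Lemma kunneth_additive :
  {morph (@kunneth _ _ P A l p : EH -> HE) : x y / x + y}.
Proof. exact: (ext_liftD (kunneth_balanced P A l p)). Qed.

Lemma kunneth_scale a (x : EH) : kunneth (a *: x) = a *: kunneth x.
Proof.
elim/ext_ind: x => [|v r|x y Ex Ey].
- rewrite scaler0; have K0 : kunneth (0 : EH) = 0.
    by apply: (addrI (kunneth (0 : EH))); rewrite -kunneth_additive !addr0.
  by rewrite K0 scaler0.
- have [z Zz ->] := hclP v; rewrite tensZr !kunnethE // -hclZ ?tensZr //.
  exact: tens_cycle.
- by rewrite scalerDr !kunneth_additive Ex Ey scalerDr.
Qed.

End KunnethLinear.

Section KunnethInverse.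
Variables (k : fieldType) (n : nat) (P : truncOperad k n) (A : kAlg k).
Variables (l : 'I_n) (p : int) (h : P l (p - 1) -> P l p).
Hypotheses (lh : linear h).
Hypothesis hK : forall v, cx_d (deg_pred p) (h (cx_d (deg_pred p) v))
  = cx_d (deg_pred p) v.
Local Notation d := (@cx_d _ (P l) p (p - 1) (deg_pred p)).
Local Notation EH := (ext_operad A (homology_operad P) l p).
Local Notation HE := (homology (ext_operad A P l) p).

(** As d h d = d, this is a projection onto the cycles. *)
Definition to_cycle (v : P l p) : P l p := v - h (d v).

Lemma to_cycle_linear : linear to_cycle.
Proof.
move=> a v w; rewrite /to_cycle (cx_d_linear (deg_pred p)) lh.
by rewrite scalerBr opprD addrACA.
Qed.

Lemma to_cycle_cycle v : is_cycle (to_cycle v).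
Proof. by apply/eqP; rewrite (linB (cx_d_linear _)) hK subrr. Qed.

Lemma to_cycle_id z : is_cycle z -> to_cycle z = z.
Proof. by move=> /eqP dz; rewrite /to_cycle dz (lin0 lh) subr0. Qed.

Definition cycle_class (v : P l p) : homology (P l) p := hcl (to_cycle v).

Lemma cycle_class_linear : linear cycle_class.
Proof.
move=> a v w; rewrite /cycle_class to_cycle_linear.
by rewrite hclD ?hclZ //; do ?apply: cycleZ; exact: to_cycle_cycle.
Qed.

Lemma cycle_class_boundary (x : ext_operad A P l p) :
  is_boundary x -> ext_map cycle_class x = 0.
Proof.
have lq := cycle_class_linear.
case=> y <- {x}; move: y; apply: (@ext_ext _ A (P l (p + 1)) _ _ (fun=> 0)).
- by move=> x y; rewrite edD (ext_mapD lq).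
- by move=> x y; rewrite addr0.
move=> v r; rewrite edE (ext_mapE lq).
have Bd : is_boundary (cx_d (erefl (p + 1)) v) by exists v.
rewrite /cycle_class to_cycle_id; last exact: boundary_cycle.
have -> : hcl (cx_d (erefl (p + 1)) v) = 0.
  rewrite -(hcl0 (P l) p); apply/hcl_eq; rewrite ?subr0 //; last exact: cycle0.
  exact: boundary_cycle.
exact/ext_clsP/tens0r.
Qed.

(** [cycle_class] is defined on all chains, so that it extends to P (x) A; there it
    kills the boundaries and induces a left inverse of the Kuenneth map. *)
Lemma kunneth_injective : injective (@kunneth _ _ P A l p).
Proof.
have lq := cycle_class_linear.
apply: (can_inj (g := fun y : HE => ext_map cycle_class (hrep y) : EH)) => x.
have E (z : ext_operad A P l p) : is_cycle z ->
    ext_map cycle_class (hrep (hcl z)) = ext_map cycle_class z.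
  move=> Zz; apply/eqP; rewrite -subr_eq0 -(linB (ext_map_linear lq)).
  by rewrite cycle_class_boundary //; exact: hclK.
have D (y y' : HE) : ext_map cycle_class (hrep (y + y'))
    = ext_map cycle_class (hrep y) + ext_map cycle_class (hrep y').
  have [[z Zz ->] [w Zw ->]] := (hclP y, hclP y').
  rewrite -hclD // !E //; last exact: cycleD.
  exact: (ext_mapD lq).
move: x; apply: (@ext_ext _ A (homology (P l) p) _ _ id) => [x y|//|v r].
  by rewrite kunneth_additive D.
have [z Zz ->] := hclP v; rewrite kunnethE // E; last exact: tens_cycle.
by rewrite (ext_mapE lq) /cycle_class to_cycle_id.
Qed.

(** A cycle of P (x) A is fixed by the extension of [to_cycle], hence it is a sum
    of tensors z (x) r with z a cycle. *)
Lemma kunneth_surjective (y : HE) : exists x : EH, kunneth x = y.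
Proof.
have [z Zz ->] := hclP y.
have lz := to_cycle_linear; have lq := cycle_class_linear.
exists (ext_map cycle_class z).
have Ez : z = ext_map to_cycle z.
  have E : ext_map to_cycle =1 (fun x : ext_operad A P l p =>
      x - ext_map h (cx_d (deg_pred p) x)).
    apply: (@ext_ext _ A (P l p) (ext A (P l p))) => [x y'|x y'|v r].
    - exact: (ext_mapD lz).
    - by rewrite edD (ext_mapD lh) opprD addrACA.
    - rewrite edE (ext_mapE lz) (ext_mapE lh).
      by apply/eqP; rewrite eq_sym subr_eq -tensDl /to_cycle subrK.
  by rewrite E (eqP Zz) ext_map0 ?subr0.
rewrite {2}Ez => {Zz Ez y}.
have Zt (x : ext_operad A P l p) :
    is_cycle (ext_map to_cycle x : ext_operad A P l p).
  elim/ext_ind: x => [|v r|x y Zx Zy].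
  - by rewrite ext_map0 //; exact: cycle0.
  - by rewrite (ext_mapE lz); apply/tens_cycle/to_cycle_cycle.
  - by rewrite (ext_mapD lz); exact: cycleD.
elim/ext_ind: z => [|v r|x y Ex Ey].
- rewrite !ext_map0 // hcl0; apply: (addrI (kunneth (0 : EH))).
  by rewrite -kunneth_additive !addr0.
- rewrite (ext_mapE lq) (ext_mapE lz) kunnethE //; exact: to_cycle_cycle.
- by rewrite (ext_mapD lq) (ext_mapD lz) kunneth_additive Ex Ey hclD.
Qed.

End KunnethInverse.

(** * The action of automorphisms on homology *)

Arguments mor_linear {R n P Q f} _ l p.

Section OperadMorphisms.
Variables (R : comPzRingType) (n : nat).

Lemma operad_mor_comp (P Q S : truncOperad R n)
    (f : forall (l : 'I_n) (p : int), P l p -> Q l p)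
    (g : forall (l : 'I_n) (p : int), Q l p -> S l p) :
  is_operad_mor f -> is_operad_mor g -> is_operad_mor (fun l p x => g l p (f l p x)).
Proof.
move=> mf mg; split=> [l p a x y|||] *.
- by rewrite (mor_linear mf) (mor_linear mg).
- by rewrite (mor_d mf) (mor_d mg).
- by rewrite (mor_act mf) (mor_act mg).
- by rewrite (mor_circ mf) (mor_circ mg).
Qed.

Lemma operad_mor_inv (P Q : truncOperad R n)
    (f : forall (l : 'I_n) (p : int), P l p -> Q l p)
    (g : forall (l : 'I_n) (p : int), Q l p -> P l p) :
  is_operad_mor f -> (forall l p, cancel (f l p) (g l p)) ->
  (forall l p, cancel (g l p) (f l p)) -> is_operad_mor g.
Proof.
move=> mf fK gK; split.
- by move=> l p a x y; rewrite -{1}(gK l p x) -{1}(gK l p y) -(mor_linear mf) fK.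
- by move=> l p p' e x; rewrite -{1}(gK l p x) -(mor_d mf) fK.
- by move=> l p s x; rewrite -{1}(gK l p x) -(mor_act mf) fK.
- move=> l m r i p q u er eu a b.
  by rewrite -{1}(gK l p a) -{1}(gK m q b) -(mor_circ mf) fK.
Qed.

Section HomologyMap.
Variables (P : truncOperad R n).

Lemma aut_cycle (f : operad_aut P) l p (x : P l p) : is_cycle x -> is_cycle (f l p x).
Proof.
move=> /is_cycleP Zx; apply/is_cycleP => j e.
by rewrite -(mor_d (aut_mor f)) Zx (lin0 (mor_linear (aut_mor f) _ _)).
Qed.

Lemma aut_boundary (f : operad_aut P) l p (x : P l p) :
  is_boundary x -> is_boundary (f l p x).
Proof. by case=> y <-; exists (f l _ y); rewrite (mor_d (aut_mor f)). Qed.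

Lemma hom_mapE (f : operad_aut P) l p (x : P l p) :
  is_cycle x -> hom_map f (hcl x) = hcl (f l p x).
Proof.
apply: (hmapE (f := f l p)).
- exact: mor_linear (aut_mor f) _ _.
- by move=> y; exact: aut_cycle.
- by move=> y; exact: aut_boundary.
Qed.

Lemma hom_map_mor (f : operad_aut P) :
  @is_operad_mor R n (homology_operad P) (homology_operad P)
    (fun l p => @hom_map R n P f l p).
Proof.
split.
- move=> l p; apply: (hmap_linear (f := f l p)).
  + exact: mor_linear (aut_mor f) _ _.
  + by move=> y; exact: aut_cycle.
  + by move=> y; exact: aut_boundary.
- move=> l p p' e x; rewrite /hom_map /=.
  rewrite -[X in hrep X](hcl0 (P l) p') -/(hom_map f _) hom_mapE; last exact: cycle0.
  by rewrite (lin0 (mor_linear (aut_mor f) _ _)) hcl0.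
- move=> l p s x; have [z Zz ->] := hclP x.
  rewrite [X in hom_map f X](hactE s Zz) !hom_mapE //; last exact: act_cycle.
  by rewrite [RHS](hactE s (aut_cycle f Zz)) (mor_act (aut_mor f)).
- move=> l m r i p q u er eu x y.
  have [[z Zz ->] [w Zw ->]] := (hclP x, hclP y).
  rewrite [X in hom_map f X](hcircE i er eu Zz Zw) !hom_mapE //; last exact: circ_cycle.
  rewrite [RHS](hcircE i er eu (aut_cycle f Zz) (aut_cycle f Zw)).
  by rewrite (mor_circ (aut_mor f)).
Qed.

Lemma hom_mapM (f g : operad_aut P) l p (x : homology_operad P l p) :
  hom_map (f * g)%g x = hom_map f (hom_map g x).
Proof.
by have [z Zz ->] := hclP x; rewrite !hom_mapE //; exact: aut_cycle.
Qed.

Lemma hom_map1 l p (x : homology_operad P l p) : hom_map (1%g : operad_aut P) x = x.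
Proof. by have [z Zz ->] := hclP x; rewrite hom_mapE. Qed.

End HomologyMap.
End OperadMorphisms.

Section HomologyFunctor.
Variables (k : fieldType) (n : nat) (P : truncOperad k n).
Local Notation HP := (homology_operad P).

Lemma kunneth_mor (A : kAlg k) :
  @is_operad_mor A n (ext_operad A HP) (homology_operad (ext_operad A P))
    (fun l p => @kunneth k n P A l p).
Proof.
have KD l p := @kunneth_additive k n P A l p.
split.
- by move=> l p a x y; rewrite KD kunneth_scale.
- move=> l p p' e; apply: (@ext_ext k A (HP l p) _ _ (fun=> 0)) => [x y|x y|v r].
  + by rewrite edD KD.
  + by rewrite addr0.
  + have [z Zz ->] := hclP v; rewrite edE -[X in tens X r](hcl0 (P l) p').
    rewrite kunnethE; last exact: cycle0.
    have -> : tens (0 : P l p') r = 0 :> ext A (P l p') by apply/ext_clsP/tens0r.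
    exact: hcl0.
- move=> l p s; apply: (@ext_ext k A (HP l p)) => [x y|x y|v r].
  + by rewrite [op_act _ _]eactD KD.
  + by rewrite KD (linD (op_act_linear s)).
  + have [z Zz ->] := hclP v; rewrite [op_act _ _]eactE [op_act _ _](hactE s Zz).
    rewrite !kunnethE //; last exact: act_cycle.
    by rewrite [RHS](hactE s (tens_cycle _ Zz)) [X in _ = hcl X]eactE.
- move=> l m t i p q u er eu a b; move: a.
  apply: (@ext_ext k A (HP l p)) => [a a'|a a'|a x].
  + by rewrite [op_circ _ _ _ _ _]ecircDl KD.
  + by rewrite KD (linD (op_circ_linl _ _ _ _)).
  move: b; apply: (@ext_ext k A (HP m q)) => [b b'|b b'|b y].
  + by rewrite [op_circ _ _ _ _ _]ecircDr KD.
  + by rewrite KD (linD (op_circ_linr _ _ _ _)).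
  have [[z Zz ->] [w Zw ->]] := (hclP a, hclP b).
  rewrite [op_circ _ _ _ _ _]ecircE [op_circ _ _ _ _ _](hcircE i er eu Zz Zw).
  rewrite !kunnethE //; last exact: circ_cycle.
  rewrite [RHS](hcircE i er eu (tens_cycle _ Zz) (tens_cycle _ Zw)).
  by rewrite [X in _ = hcl X]ecircE.
Qed.

(** For y = [z] (x) r, both sides of the last equation are the class of
    z (x) g r; stating it through representatives avoids the map induced by g on
    homology. *)
Lemma kunneth_bc (A B : kAlg k) (g : algHom A B) l p
    (y : ext_operad A HP l p) (w : ext_operad A P l p) :
  is_cycle w -> kunneth y = hcl w ->
  is_cycle (ext_mor g w : ext_operad B P l p) /\
  kunneth (ext_mor g y : ext_operad B HP l p) = hcl (ext_mor g w : ext_operad B P l p).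
Proof.
have Zg (x : ext_operad A P l p) :
    is_cycle x -> is_cycle (ext_mor g x : ext_operad B P l p).
  by move=> /eqP dx; apply/eqP; rewrite -mor_ed dx ext_mor0.
have Bg (x : ext_operad A P l p) :
    is_boundary x -> is_boundary (ext_mor g x : ext_operad B P l p).
  by case=> z <-; exists (ext_mor g z); rewrite mor_ed.
move=> Zw Ey; split; first exact: Zg.
(* Two representatives differ by a boundary, so one of them is enough. *)
suff [v [Zv E1 E2]] : exists v : ext_operad A P l p,
    [/\ is_cycle v, kunneth y = hcl v
      & kunneth (ext_mor g y : ext_operad B HP l p)
        = hcl (ext_mor g v : ext_operad B P l p)].
  rewrite E2; apply/hcl_eq; [exact: Zg | exact: Zg |].
  have : is_boundary (v - w) by apply/hcl_eq => //; rewrite -E1.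
  move=> /Bg; suff -> : ext_mor g (v - w) = ext_mor g v - ext_mor g w by [].
  by rewrite ext_morD -scaleN1r ext_morZ rmorphN1 scaleN1r.
move: y {Ey w Zw}; apply: ext_ind => [|h r|x y [v [Zv Ev Ev']] [w [Zw Ew Ew']]].
- exists 0; split; first exact: cycle0.
    by rewrite (lin0 (mor_linear (kunneth_mor A) l p)) hcl0.
  rewrite !ext_mor0 hcl0.
  exact: (lin0 (mor_linear (kunneth_mor B) l p)).
- have [z Zz ->] := hclP h; exists (tens z r); split; first exact: tens_cycle.
    exact: kunnethE.
  by rewrite !ext_morE kunnethE.
- exists (v + w); split; first exact: cycleD.
    by rewrite kunneth_additive Ev Ew hclD.
  by rewrite !ext_morD kunneth_additive Ev' Ew' hclD //; exact: Zg.
Qed.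

Hypothesis kunneth_inj : forall (A : kAlg k) l p, injective (@kunneth k n P A l p).
Hypothesis kunneth_surj : forall (A : kAlg k) l p y, exists x, @kunneth k n P A l p x = y.

Definition kunneth_inv (A : kAlg k) (l : 'I_n) (p : int)
  (y : homology_operad (ext_operad A P) l p) : ext_operad A HP l p :=
  projT1 (cid (kunneth_surj y)).

Lemma kunneth_invK (A : kAlg k) l p : cancel (@kunneth_inv A l p) (@kunneth k n P A l p).
Proof. by move=> y; exact: projT2 (cid (kunneth_surj y)). Qed.

Lemma kunnethK (A : kAlg k) l p : cancel (@kunneth k n P A l p) (@kunneth_inv A l p).
Proof. by move=> x; apply: kunneth_inj; rewrite kunneth_invK. Qed.

Definition hom_fun (A : kAlg k) (f : AutF P A) (l : 'I_n) (p : int)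
    (x : ext_operad A HP l p) : ext_operad A HP l p :=
  kunneth_inv (hom_map f (kunneth x)).

Lemma hom_fun_mor (A : kAlg k) (f : AutF P A) :
  @is_operad_mor A n (ext_operad A HP) (ext_operad A HP) (@hom_fun A f).
Proof.
have mi := operad_mor_inv (kunneth_mor A) (@kunnethK A) (@kunneth_invK A).
exact: (operad_mor_comp (operad_mor_comp (kunneth_mor A) (hom_map_mor f)) mi).
Qed.

Lemma hom_funK (A : kAlg k) (f g : AutF P A) : (f * g = 1)%g ->
  forall l p, cancel (@hom_fun A g l p) (@hom_fun A f l p).
Proof.
by move=> fg l p x; rewrite /hom_fun kunneth_invK -hom_mapM fg hom_map1 kunnethK.
Qed.

Definition hom_aut (A : kAlg k) (f : AutF P A) : AutF HP A :=
  @OperadAut A n (ext_operad A HP) (@hom_fun A f) (@hom_fun A f^-1%g)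
    (hom_fun_mor f) (hom_fun_mor f^-1%g)
    (hom_funK (mulVg f)) (hom_funK (mulgV f)).

Lemma kunneth_hom_aut (A : kAlg k) (f : AutF P A) l p (x : ext_operad A HP l p) :
  kunneth ((hom_aut f : operad_aut _) l p x) = hom_map f (kunneth x).
Proof. exact: kunneth_invK. Qed.

Lemma hom_autM (A : kAlg k) (f g : AutF P A) :
  hom_aut (f * g)%g = (hom_aut f * hom_aut g)%g.
Proof.
apply: aut_eq => l p x; apply: kunneth_inj.
by rewrite kunneth_hom_aut hom_mapM !kunneth_hom_aut.
Qed.

(** Both sides are determined by their effect on tensors [z] (x) s, which the
    Kuenneth map sends to the class of the image of z (x) s under the extension of
    f to B. *)
Lemma hom_aut_nat (A B : kAlg k) (g : algHom A B) (f : AutF P A) :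
  hom_aut (gf_map g f) = gf_map g (hom_aut f).
Proof.
have LA l p := mor_linear (aut_mor (hom_aut f : operad_aut _)) l p.
have Lf l p := mor_linear (aut_mor (f : operad_aut _)) l p.
apply: aut_eq => l p x; apply: kunneth_inj; rewrite kunneth_hom_aut; move: x.
have HM := mor_linear (hom_map_mor (gf_map g f : operad_aut _)) l p.
apply: (@ext_ext k B (HP l p)) => [x y|x y|v s].
- by rewrite kunneth_additive (linD HM).
- by rewrite [aut_fun _ _]/= (ext_bcD g (@LA l p)) kunneth_additive.
have [z Zz ->] := hclP v; rewrite kunnethE // hom_mapE; last exact: tens_cycle.
rewrite [in LHS]/= [in RHS]/= (ext_bcE g (@LA l p)) (ext_bcE g (@Lf l p)).
have Zf : is_cycle ((f : operad_aut _) l p (tens z 1)).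
  by apply: aut_cycle; exact: tens_cycle.
have E : kunneth ((hom_aut f : operad_aut _) l p (tens (hcl z) 1))
    = hcl ((f : operad_aut _) l p (tens z 1)).
  by rewrite kunneth_hom_aut kunnethE // hom_mapE //; exact: tens_cycle.
have [Zg Eg] := kunneth_bc g Zf E.
by rewrite kunneth_scale Eg -hclZ.
Qed.

Definition homology_functor_mor : groupFunctorMor (AutF P) (AutF HP) :=
  @GroupFunctorMor k (AutF P) (AutF HP) hom_aut hom_autM hom_aut_nat.

Lemma homology_functor_mor_induced : induced_on_homology homology_functor_mor.
Proof. by move=> A f l p x; exact: kunneth_hom_aut. Qed.

Lemma induced_on_homology_unique (H H' : groupFunctorMor (AutF P) (AutF HP)) :
  induced_on_homology H -> induced_on_homology H' ->
  forall (A : kAlg k) (f : AutF P A), H' A f = H A f.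
Proof.
by move=> iH iH' A f; apply: aut_eq => l p x; apply: kunneth_inj; rewrite iH iH'.
Qed.

End HomologyFunctor.

(** * Equations for the matrices that preserve given operations *)

Section StructureConstants.
Variables (U W : finType) (N : nat).

Section Ring.
Variable R : comPzRingType.

(** The matrix M, acting by e_x |-> \sum_y M y x e_y, commutes with the operation of
    matrix [a] when this vanishes. *)
Definition unary_defect (M a : 'M[R]_N) : 'M[R]_N := M *m a - a *m M.

(** Here [c x y] is the column of coordinates of the product of the basis vectors
    of indices x and y; the difference is M (e_x e_y) - (M e_x) (M e_y). *)
Definition binary_defect (M : 'M[R]_N) (c : 'I_N -> 'I_N -> 'cV[R]_N) (x y : 'I_N) :
    'cV[R]_N :=
  M *m c x y - \sum_x' \sum_y' (M x' x * M y' y) *: c x' y'.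

Definition preserves (a : U -> 'M[R]_N) (c : W -> 'I_N -> 'I_N -> 'cV[R]_N)
    (M : 'M[R]_N) : Prop :=
  (forall u, unary_defect M (a u) = 0) /\
  (forall w x y, binary_defect M (c w) x y = 0).

End Ring.

Lemma unary_defect_map (R S : comPzRingType) (f : {rmorphism R -> S}) (M a : 'M[R]_N) :
  map_mx f (unary_defect M a) = unary_defect (map_mx f M) (map_mx f a).
Proof. by rewrite /unary_defect map_mxB !map_mxM. Qed.

Lemma binary_defect_map (R S : comPzRingType) (f : {rmorphism R -> S}) (M : 'M[R]_N)
    (c : 'I_N -> 'I_N -> 'cV[R]_N) x y :
  map_mx f (binary_defect M c x y) =
    binary_defect (map_mx f M) (fun x y => map_mx f (c x y)) x y.
Proof.
rewrite /binary_defect map_mxB map_mxM; congr (_ - _).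
apply/matrixP => z o; rewrite mxE !summxE raddf_sum; apply: eq_bigr => x' _ /=.
rewrite !summxE raddf_sum; apply: eq_bigr => y' _ /=.
by rewrite !mxE !rmorphM.
Qed.

Section Equations.
Variables (k : fieldType) (a : U -> 'M[k]_N) (c : W -> 'I_N -> 'I_N -> 'cV[k]_N).
Local Notation K := (poly_alg k (N * N)).

Definition generic_matrix : 'M[K]_N := \matrix_(i, j) 'X_(mxvec_index i j).

Definition unary_equation (t : U * 'I_N * 'I_N) : {mpoly k[N * N]} :=
  unary_defect generic_matrix (map_mx (alg_str K) (a t.1.1)) t.1.2 t.2.

Definition binary_equation (t : W * 'I_N * 'I_N * 'I_N) : {mpoly k[N * N]} :=
  binary_defect generic_matrix (fun x y => map_mx (alg_str K) (c t.1.1.1 x y))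
    t.1.1.2 t.1.2 t.2 0.

Definition structure_equations : seq {mpoly k[N * N]} :=
  codom unary_equation ++ codom binary_equation.

(** The two sides of each equation are computed from the matrix of variables, and
    evaluation at [g] is a ring morphism that sends this matrix to [g]. *)
Lemma structure_equationsP (A : kAlg k) (g : 'M[A]_N) :
  (forall p, p \in structure_equations -> alg_eval (mxvec g 0) p = 0) <->
  preserves (fun u => map_mx (alg_str A) (a u))
    (fun w x y => map_mx (alg_str A) (c w x y)) g.
Proof.
pose f : {rmorphism K -> A} := eval_hom (mxvec g 0).
have fX : map_mx f generic_matrix = g.
  by apply/matrixP => i j; rewrite !mxE [LHS]eval_morX mxvecE.
have fC p q (m : 'M[k]_(p, q)) : map_mx f (map_mx (alg_str K) m) = map_mx (alg_str A) m.
  by apply/matrixP => i j; rewrite !mxE [LHS]eval_morC.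
have uE t : alg_eval (mxvec g 0) (unary_equation t)
    = unary_defect g (map_mx (alg_str A) (a t.1.1)) t.1.2 t.2.
  by rewrite -eval_morE -[LHS]/(f _) -[g in RHS]fX -fC -unary_defect_map [RHS]mxE.
have bE t : alg_eval (mxvec g 0) (binary_equation t)
    = binary_defect g (fun x y => map_mx (alg_str A) (c t.1.1.1 x y)) t.1.1.2 t.1.2 t.2 0.
  rewrite -eval_morE -[LHS]/(f _) -[g in RHS]fX.
  have -> : (fun x y => map_mx (alg_str A) (c t.1.1.1 x y)) =
      (fun x y => map_mx f (map_mx (alg_str K) (c t.1.1.1 x y))).
    by do 2 apply: functional_extensionality_dep => ?; rewrite fC.
  by rewrite -binary_defect_map [RHS]mxE.
split=> [E|[Eu Eb] p].
  split=> [u|w x y]; apply/matrixP => i j; rewrite [RHS]mxE.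
    rewrite -(uE (u, i, j)) E // mem_cat; apply/orP; left; exact: codom_f.
  rewrite ord1 -(bE (w, x, y, i)) E // mem_cat; apply/orP; right; exact: codom_f.
rewrite mem_cat => /orP[]/codomP[t ->]; rewrite ?uE ?bE ?Eu ?Eb mxE //.
Qed.

End Equations.
End StructureConstants.

(** * Automorphisms of an operad with a graded basis, as matrices *)

(** A basis of the sum of all the Q(l)_p.  The vector of index x lies in the piece of
    arity index [gb_ar x] and degree [gb_deg x], but [gb_vec] and [gb_coord] make
    sense in every piece, with the value 0 in the other ones: in this way no
    transport between pieces with provably equal indices is ever needed. *)
Record graded_basis (R : comPzRingType) (n : nat) (Q : truncOperad R n) (N : nat) :=
  GradedBasis {
  gb_ar : 'I_N -> 'I_n;
  gb_deg : 'I_N -> int;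
  gb_vec : forall (l : 'I_n) (p : int), 'I_N -> Q l p;
  gb_coord : forall (l : 'I_n) (p : int), Q l p -> 'cV[R]_N;
  gb_coord_linear : forall l p, linear (@gb_coord l p);
  gb_expand : forall l p (v : Q l p), v = \sum_x gb_coord v x 0 *: gb_vec l p x;
  gb_coord_vec : forall l p x, gb_coord (gb_vec l p x)
    = if (gb_ar x == l) && (gb_deg x == p) then delta_mx x 0 else 0 }.

Arguments gb_coord {R n Q N} g {l p} v.
Arguments gb_coord_linear {R n Q N} g l p.

Section AutMatrix.
Variables (R : comPzRingType) (n : nat) (Q : truncOperad R n) (N : nat).
Variable b : graded_basis Q N.
Local Notation ar := (gb_ar b).
Local Notation deg := (gb_deg b).
Local Notation coord := (gb_coord b).
Local Notation vec := (gb_vec b).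
Local Notation basis x := (vec (ar x) (deg x) x).
Local Notation in_grade x l p := ((ar x == l) && (deg x == p)).

Lemma coord_basis x : coord (basis x) = delta_mx x 0.
Proof. by rewrite gb_coord_vec !eqxx. Qed.

Lemma coord_inj l p : injective (@gb_coord _ _ _ _ b l p).
Proof. by move=> v w E; rewrite (gb_expand b v) (gb_expand b w) E. Qed.

Lemma coord_off l p (v : Q l p) x : ~~ in_grade x l p -> coord v x 0 = 0.
Proof.
move=> xlp; rewrite (gb_expand b v) (lin_sum _ _ (gb_coord_linear b l p)) summxE.
apply: big1 => y _; rewrite mxE gb_coord_vec.
case: ifP => [ylp|_]; rewrite mxE ?mulr0 //.
by have [E|] := eqVneq x y; [rewrite E ylp in xlp | rewrite mulr0].
Qed.

Section Operators.
Variable sh : int -> int.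
Variable f : forall (l : 'I_n) (p : int), Q l p -> Q l (sh p).
Hypothesis lf : forall l p, linear (@f l p).

(** The matrix of a homogeneous operator on the sum of all the pieces. *)
Definition opmx : 'M[R]_N := \matrix_(z, x) coord (@f (ar x) (deg x) (basis x)) z 0.

Lemma opmxE l p (v : Q l p) : coord (@f l p v) = opmx *m coord v.
Proof.
apply/colP => z; rewrite {1}(gb_expand b v) (lin_sum _ _ (@lf l p)).
rewrite (lin_sum _ _ (gb_coord_linear b _ _)) summxE mxE.
apply: eq_bigr => x _; rewrite mxE mulrC.
have [|/coord_off ->] := boolP (in_grade x l p); last by rewrite !mulr0.
by case/andP => /eqP El /eqP Ep; subst l p; rewrite [in RHS]mxE.
Qed.

End Operators.

Lemma opmx_id : opmx (fun l p (v : Q l p) => v) = 1%:M.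
Proof. by apply/matrixP => z x; rewrite !mxE coord_basis mxE andbT. Qed.

Lemma opmx_comp (s t : int -> int)
    (f : forall (l : 'I_n) (p : int), Q l p -> Q l (s p))
    (g : forall (l : 'I_n) (p : int), Q l p -> Q l (t p)) :
  (forall l p, linear (f l p)) ->
  opmx (fun l p v => f l (t p) (g l p v)) = opmx f *m opmx g.
Proof.
move=> lf; apply/matrixP => z x; rewrite mxE (opmxE lf) !mxE.
by apply: eq_bigr => y _; rewrite [opmx g _ _]mxE.
Qed.

Lemma opmx_inj (s : int -> int)
    (f g : forall (l : 'I_n) (p : int), Q l p -> Q l (s p)) :
  (forall l p, linear (f l p)) -> (forall l p, linear (g l p)) ->
  opmx f = opmx g -> forall l p v, f l p v = g l p v.
Proof. by move=> lf lg E l p v; apply: coord_inj; rewrite !opmxE // E. Qed.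

Definition grade_proj (y : 'I_N) (l : 'I_n) (p : int) (v : Q l p) : Q l p :=
  if in_grade y l p then v else 0.
Definition deg_diff (l : 'I_n) (p : int) (v : Q l p) : Q l (p - 1) :=
  cx_d (deg_pred p) v.
(** One permutation for each arity, so that this acts on all the pieces at once. *)
Definition family_act (s : {dffun forall l : 'I_n, {perm 'I_l.+1}}) (l : 'I_n) (p : int)
  (v : Q l p) : Q l p := op_act (s l) v.

Definition unary_op := ('I_N + option {dffun forall l : 'I_n, {perm 'I_l.+1}})%type.

Definition unary_constants (u : unary_op) : 'M[R]_N :=
  match u with
  | inl y => opmx (grade_proj y)
  | inr None => opmx deg_diff
  | inr (Some s) => opmx (family_act s)
  end.

(** The index (i, r) stands for the composition o_i with values in arity index r,
    extended by 0 to the pairs (x, y) whose composite has another arity.  On pairs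
    with i > [ar x] it is some other composition of Q, since [inord] then returns a
    default index; the equations for it hold all the same. *)
Definition binary_constants (w : 'I_n * 'I_n) (x y : 'I_N) : 'cV[R]_N :=
  match w.2 =P (ar x + ar y)%N :> nat with
  | ReflectT er =>
      coord (op_circ (inord w.1 : 'I_(ar x).+1) er erefl (basis x) (basis y))
  | ReflectF _ => 0
  end.

Lemma grade_proj_linear y l p : linear (@grade_proj y l p).
Proof. by move=> a v w; rewrite /grade_proj; case: ifP; rewrite ?scaler0 ?addr0. Qed.
Lemma deg_diff_linear l p : linear (@deg_diff l p).
Proof. exact: cx_d_linear. Qed.
Lemma family_act_linear s l p : linear (@family_act s l p).
Proof. exact: op_act_linear. Qed.

Lemma binary_constantsE (l m r : 'I_n) (i : 'I_l.+1) (j : 'I_n) (p q u : int)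
    (er : r = (l + m)%N :> nat) (eu : u = p + q) (v : Q l p) (w : Q m q) :
  j = i :> nat ->
  coord (op_circ i er eu v w) =
    \sum_x \sum_y (coord v x 0 * coord w y 0) *: binary_constants (j, r) x y.
Proof.
move=> ji; rewrite {1}(gb_expand b v).
rewrite (lin_sum _ _ (op_circ_linl i er eu w)) (lin_sum _ _ (gb_coord_linear b _ _)).
apply: eq_bigr => x _; rewrite {1}(gb_expand b w).
rewrite (lin_sum _ _ (op_circ_linr i er eu _)) (lin_sum _ _ (gb_coord_linear b _ _)).
rewrite scaler_sumr; apply: eq_bigr => y _; rewrite scalerA.
have [xlp|/coord_off ->] := boolP (in_grade x l p); last by rewrite mul0r !scale0r.
have [ymq|/coord_off ->] := boolP (in_grade y m q); last by rewrite mulr0 !scale0r.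
case/andP: xlp ymq => /eqP El /eqP Ep /andP[/eqP Em /eqP Eq]; subst l p m q u.
rewrite /binary_constants; case: eqP => //= er'.
by rewrite (eq_irrelevance er' er) ji inord_val.
Qed.

(** In column x, commutation with the projection onto the grade of x says that the
    entries outside this grade vanish. *)
Lemma preserves_block (M : 'M[R]_N) :
  (forall y, M *m opmx (grade_proj y) = opmx (grade_proj y) *m M) ->
  forall z x, ~~ in_grade z (ar x) (deg x) -> M z x = 0.
Proof.
move=> cM z x zx; have /matrixP/(_ z x) := cM x.
rewrite !mxE (bigD1 x) //= big1 ?addr0 => [|y yx]; last first.
  by rewrite mxE /grade_proj !eqxx coord_basis mxE (negPf yx) mulr0.
rewrite mxE /grade_proj !eqxx coord_basis mxE !eqxx mulr1 => ->.
apply: big1 => y _; rewrite mxE /grade_proj.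
have [E|zy] := eqVneq z y.
  case: ifP => [/andP[/eqP Ea /eqP Ed]|_].
    by rewrite E -Ea -Ed !eqxx in zx.
  by rewrite (lin0 (gb_coord_linear b _ _)) mxE mul0r.
case: ifP => _; last by rewrite (lin0 (gb_coord_linear b _ _)) mxE mul0r.
by rewrite coord_basis mxE (negPf zy) mul0r.
Qed.

Section FromMatrix.
Variable M : 'M[R]_N.
Hypothesis cM : forall y, M *m opmx (grade_proj y) = opmx (grade_proj y) *m M.

Definition mx_fun (l : 'I_n) (p : int) (v : Q l p) : Q l p :=
  \sum_z (M *m coord v) z 0 *: vec l p z.

Lemma coord_mx_fun l p (v : Q l p) : coord (mx_fun v) = M *m coord v.
Proof.
apply/colP => z; rewrite /mx_fun (lin_sum _ _ (gb_coord_linear b l p)) summxE.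
rewrite (bigD1 z) //= big1 ?addr0 => [|y yz]; last first.
  rewrite [LHS]mxE gb_coord_vec; case: ifP => _; rewrite [X in _ * X]mxE ?mulr0 //.
  by rewrite eq_sym (negPf yz) mulr0.
rewrite [LHS]mxE gb_coord_vec; case: ifP => [_|/negbT zlp]; rewrite [X in _ * X]mxE.
  by rewrite !eqxx mulr1.
rewrite mulr0 mxE; apply/esym/big1 => x _.
have [|/coord_off ->] := boolP (in_grade x l p); last by rewrite mulr0.
case/andP => /eqP El /eqP Ep; subst l p.
by rewrite (preserves_block cM) ?mul0r.
Qed.

Lemma mx_fun_linear l p : linear (@mx_fun l p).
Proof.
move=> a v w; apply: coord_inj.
by rewrite coord_mx_fun !gb_coord_linear !coord_mx_fun mulmxDr -scalemxAr.
Qed.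

Lemma opmx_mx_fun : opmx mx_fun = M.
Proof.
apply/matrixP => z x; rewrite mxE coord_mx_fun coord_basis mxE.
rewrite (bigD1 x) //= big1 ?addr0 => [|y yx]; rewrite mxE ?(negPf yx) ?mulr0 //.
by rewrite !eqxx mulr1.
Qed.

End FromMatrix.

Definition aut_mx (f : operad_aut Q) : 'M[R]_N := opmx f.

Lemma aut_mx_inj : injective aut_mx.
Proof.
move=> f g E; apply: aut_eq => l p x.
exact: (opmx_inj (mor_linear (aut_mor f)) (mor_linear (aut_mor g)) E).
Qed.

Lemma aut_mxM (f g : operad_aut Q) : aut_mx (f * g)%g = aut_mx f *m aut_mx g.
Proof. exact: (opmx_comp g (mor_linear (aut_mor f))). Qed.

Lemma aut_mx1 : aut_mx 1%g = 1%:M.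
Proof. exact: opmx_id. Qed.

Lemma unary_defect0 (M a : 'M[R]_N) : unary_defect M a = 0 <-> M *m a = a *m M.
Proof. by rewrite /unary_defect; split=> [/eqP|->]; rewrite ?subr_eq0 ?subrr // => /eqP. Qed.

Lemma opmx_commute (s : int -> int) (f : forall (l : 'I_n) (p : int), Q l p -> Q l p)
    (g : forall (l : 'I_n) (p : int), Q l p -> Q l (s p)) :
  (forall l p, linear (f l p)) -> (forall l p, linear (g l p)) ->
  (opmx f *m opmx g = opmx g *m opmx f <->
   forall l p v, f l (s p) (g l p v) = g l p (f l p v)).
Proof.
move=> lf lg; rewrite -(opmx_comp g lf) -(@opmx_comp s id g f lg); split.
  move=> E; apply: opmx_inj E => l p a v w.
    by rewrite lg lf.
  by rewrite lf lg.
by move=> E; apply/matrixP => z x; rewrite !mxE E.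
Qed.

Lemma aut_mx_preserves (f : operad_aut Q) :
  preserves unary_constants binary_constants (aut_mx f).
Proof.
have mf := aut_mor f; have lf := mor_linear mf.
split=> [u|[i r] x y].
  apply/unary_defect0; case: u => [y|[s|]].
  - apply/(opmx_commute lf (grade_proj_linear y)) => l p v; rewrite /grade_proj.
    by case: ifP => _; rewrite ?(lin0 (lf l p)).
  - by apply/(opmx_commute lf (family_act_linear s)) => l p v; exact: (mor_act mf).
  - by apply/(opmx_commute lf deg_diff_linear) => l p v; exact: (mor_d mf).
apply/eqP; rewrite /binary_defect subr_eq0; apply/eqP.
rewrite {1}/binary_constants /=; case: eqP => [er|nr]; last first.
  (* f respects arities, so both sides vanish when r is the wrong arity. *)
  rewrite mulmx0; apply/esym/big1 => x' _; apply: big1 => y' _.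
  rewrite /binary_constants /=; case: eqP => [er|_]; last by rewrite scaler0.
  have [/andP[/eqP Ex _]|xx] := boolP (in_grade x' (ar x) (deg x)); last first.
    by rewrite [aut_mx f x' x]mxE (coord_off _ xx) mul0r scale0r.
  have [/andP[/eqP Ey _]|yy] := boolP (in_grade y' (ar y) (deg y)); last first.
    by rewrite [aut_mx f y' y]mxE (coord_off _ yy) mulr0 scale0r.
  by case: nr; rewrite -Ex -Ey.
rewrite -(opmxE lf) (mor_circ mf).
(* The composition that [inord i] selects on [basis x], as an index below n. *)
have xn := ltn_ord (inord i : 'I_(ar x).+1).
have xn' : ((inord i : 'I_(ar x).+1) < n)%N.
  by apply: leq_trans xn _; exact: ltn_ord.
(* f respects arities, so only x' of the same arity as x contribute. *)
have E (x' y' : 'I_N) : ar x' = ar x ->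
    binary_constants (i, r) x' y' = binary_constants (Ordinal xn', r) x' y'.
  rewrite /binary_constants /= => Ex; case: eqP => //= er'.
  by rewrite -Ex inord_val.
rewrite (binary_constantsE (j := Ordinal xn')) //.
apply: eq_bigr => x' _; apply: eq_bigr => y' _; rewrite ![aut_mx f _ _]mxE.
have [/andP[/eqP Ex _]|xx] := boolP (in_grade x' (ar x) (deg x)); first by rewrite E.
by rewrite (coord_off _ xx) !mul0r !scale0r.
Qed.

Lemma preserves_mor (M : 'M[R]_N) :
  preserves unary_constants binary_constants M ->
  @is_operad_mor R n Q Q (mx_fun M).
Proof.
move=> [Mu Mb]; have cM u : M *m unary_constants u = unary_constants u *m M.
  exact/unary_defect0.
have cP y := cM (inl y).
have lf := mx_fun_linear cP; have fM := opmx_mx_fun cP.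
split.
- exact: lf.
- move=> l p p' e x; have E : p' = p - 1 by rewrite e addrK.
  subst p'; rewrite !(cx_dE e (deg_pred p)).
  apply: (opmx_commute (g := deg_diff) lf deg_diff_linear).1.
  by rewrite fM; exact: (cM (inr None)).
- move=> l p s x.
  (* Any family of permutations with the value s in the arity at hand. *)
  pose S : {dffun forall l : 'I_n, {perm 'I_l.+1}} :=
    finfun (fun l' : 'I_n =>
      @dfwith _ (fun l : 'I_n => {perm 'I_l.+1}) (fun=> 1%g) l s l').
  have -> : s = S l by rewrite ffunE dfwith_in.
  apply: (opmx_commute (g := family_act S) lf (family_act_linear S)).1; rewrite fM.
  exact: (cM (inr (Some S))).
- move=> l m r i p q u er eu v w; apply: coord_inj.
  have il : (i < n)%N by apply: leq_trans (ltn_ord i) _; exact: ltn_ord.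
  rewrite (coord_mx_fun cP) !(binary_constantsE er eu _ _ (j := Ordinal il)) //.
  rewrite mulmx_sumr.
  transitivity (\sum_x \sum_y (coord v x 0 * coord w y 0) *:
      \sum_x' \sum_y' (M x' x * M y' y) *: binary_constants (Ordinal il, r) x' y').
    apply: eq_bigr => x _; rewrite mulmx_sumr; apply: eq_bigr => y _.
    rewrite -scalemxAr; congr (_ *: _); apply/eqP; rewrite -subr_eq0.
    exact/eqP/(Mb (Ordinal il, r)).
  (* It remains to expand and to sum over x' and y' first. *)
  under [RHS]eq_bigr do under eq_bigr do
    rewrite !(coord_mx_fun cP) !mxE big_distrlr /= scaler_suml.
  under [RHS]eq_bigr do under eq_bigr do under eq_bigr do rewrite scaler_suml.
  transitivity (\sum_x \sum_x' \sum_y \sum_y' (coord v x 0 * coord w y 0) *: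
     ((M x' x * M y' y) *: binary_constants (Ordinal il, r) x' y')).
    apply: eq_bigr => x _; rewrite exchange_big; apply: eq_bigr => y _ /=.
    by rewrite scaler_sumr; apply: eq_bigr => x' _; rewrite scaler_sumr.
  rewrite exchange_big; apply: eq_bigr => x' _ /=.
  transitivity (\sum_x \sum_y' \sum_y (coord v x 0 * coord w y 0) *:
     ((M x' x * M y' y) *: binary_constants (Ordinal il, r) x' y')).
    by apply: eq_bigr => x _; rewrite exchange_big.
  rewrite exchange_big; apply: eq_bigr => y' _ /=.
  apply: eq_bigr => x _; apply: eq_bigr => y _.
  by rewrite scalerA mulrACA mulrC [coord v x 0 * _]mulrC [coord w y 0 * _]mulrC mulrC.
Qed.

(** The inverse of a solution is block diagonal too, hence it comes from a family
    of maps; these are inverse to a bijective morphism, hence form a morphism. *)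
Lemma aut_mxP (M : 'M[R]_N) :
  ((exists h : 'M[R]_N, M *m h = 1%:M /\ h *m M = 1%:M) /\
   preserves unary_constants binary_constants M) <-> exists f, aut_mx f = M.
Proof.
split=> [[[h [Mh hM]] pM]|[f <-]]; last first.
  split; last exact: aut_mx_preserves.
  by exists (aut_mx f^-1%g); rewrite -!aut_mxM mulgV mulVg aut_mx1.
have [Mu _] := pM.
have cM y : M *m opmx (grade_proj y) = opmx (grade_proj y) *m M.
  exact/unary_defect0/(Mu (inl y)).
have ch y : h *m opmx (grade_proj y) = opmx (grade_proj y) *m h.
  by rewrite -[RHS]mul1mx -hM -mulmxA (mulmxA M) cM -!mulmxA Mh mulmx1.
have MK : forall l p, cancel (@mx_fun M l p) (@mx_fun h l p).
  by move=> l p v; apply: coord_inj; rewrite !coord_mx_fun // mulmxA hM mul1mx.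
have hK : forall l p, cancel (@mx_fun h l p) (@mx_fun M l p).
  by move=> l p v; apply: coord_inj; rewrite !coord_mx_fun // mulmxA Mh mul1mx.
have mM := preserves_mor pM.
exists (OperadAut mM (operad_mor_inv mM MK hK) MK hK).
exact: opmx_mx_fun.
Qed.

End AutMatrix.

(** * Extension of scalars of a graded basis *)

Section ExtBasis.
Variables (k : fieldType) (n : nat) (P : truncOperad k n) (N : nat).
Variables (b : graded_basis P N) (A : kAlg k).

Definition ext_coord (l : 'I_n) (p : int) (x : ext_operad A P l p) : 'cV[A]_N :=
  ext_lift (fun (v : P l p) (r : A) => r *: map_mx (alg_str A) (gb_coord b v)) x.

Lemma ext_coord_balanced l p :
  balanced (fun (v : P l p) (r : A) => r *: map_mx (alg_str A) (gb_coord b v)).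
Proof.
have lc := gb_coord_linear b l p; split=> [v w r|v r s|a v r].
- by rewrite (linD lc) map_mxD scalerDr.
- by rewrite scalerDl.
- by rewrite (linZ lc) map_mxZ scalerA mulrC.
Qed.

Lemma ext_coordE l p (v : P l p) r :
  ext_coord (tens v r : ext_operad A P l p) = r *: map_mx (alg_str A) (gb_coord b v).
Proof. exact: ext_liftE (@ext_coord_balanced l p) _ _. Qed.

Lemma ext_coordD l p : {morph @ext_coord l p : x y / x + y}.
Proof. exact: ext_liftD (@ext_coord_balanced l p). Qed.

Lemma ext_coord_linear l p : linear (@ext_coord l p).
Proof.
have c0 : ext_coord (0 : ext_operad A P l p) = 0.
  exact: ext_lift0 (@ext_coord_balanced l p).
move=> a x y; rewrite ext_coordD; congr (_ + _).
elim/ext_ind: x => [|v r|x z Ex Ez].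
- by rewrite scaler0 c0 scaler0.
- by rewrite tensZr !ext_coordE scalerA.
- by rewrite scalerDr !ext_coordD Ex Ez scalerDr.
Qed.

Definition ext_vec (l : 'I_n) (p : int) (x : 'I_N) : ext_operad A P l p :=
  tens (gb_vec b l p x) 1.

Lemma ext_expand l p (v : ext_operad A P l p) :
  v = \sum_x ext_coord v x 0 *: ext_vec l p x.
Proof.
move: v; apply: (@ext_ext k A (P l p) _ id) => [//|x y|v r].
  rewrite ext_coordD -big_split; apply: eq_bigr => z _ /=.
  by rewrite mxE scalerDl.
rewrite {1}[v](gb_expand b) ext_coordE.
rewrite (big_morph (fun v => tens v r) (tensDl r) (_ : tens 0 r = 0)); last first.
  exact/ext_clsP/tens0r.
by apply: eq_bigr => x _; rewrite !mxE tensZr mulr1 tensZl mulrC.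
Qed.

Lemma ext_coord_vec l p x : ext_coord (ext_vec l p x)
  = if (gb_ar b x == l) && (gb_deg b x == p) then delta_mx x 0 else 0.
Proof.
rewrite ext_coordE scale1r gb_coord_vec; case: ifP => _; last exact: map_mx0.
exact: map_delta_mx.
Qed.

Definition ext_basis : graded_basis (ext_operad A P) N :=
  GradedBasis ext_coord_linear ext_expand ext_coord_vec.

Lemma ext_unary_constants u :
  unary_constants ext_basis u = map_mx (alg_str A) (unary_constants b u).
Proof.
apply/matrixP => z x; case: u => [y|[s|]] /=; rewrite !mxE /=.
- rewrite /grade_proj /=; case: ifP => _; first by rewrite ext_coordE scale1r mxE.
  by rewrite (lin0 (@ext_coord_linear _ _)) (lin0 (gb_coord_linear b _ _)) !mxE rmorph0.
- by rewrite /family_act /= eactE ext_coordE scale1r mxE.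
- by rewrite /deg_diff edE ext_coordE scale1r mxE.
Qed.

Lemma ext_binary_constants w x y :
  binary_constants ext_basis w x y = map_mx (alg_str A) (binary_constants b w x y).
Proof.
rewrite /binary_constants /=; case: eqP => [er|_]; last by rewrite map_mx0.
by rewrite [X in ext_coord X]ecircE ext_coordE mulr1 scale1r.
Qed.

End ExtBasis.

Lemma ext_coord_mor (k : fieldType) (n : nat) (P : truncOperad k n) (N : nat)
    (b : graded_basis P N) (A B : kAlg k) (g : algHom A B) l p
    (x : ext_operad A P l p) :
  ext_coord b (ext_mor g x : ext_operad B P l p) = map_mx g (ext_coord b x).
Proof.
move: x; apply: (@ext_ext k A (P l p)) => [x y|x y|v r].
- by rewrite ext_morD ext_coordD.
- by rewrite ext_coordD map_mxD.
- rewrite ext_morE !ext_coordE; apply/matrixP => i j.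
  by rewrite !mxE rmorphM alg_funE.
Qed.

(** * Existence of a graded basis *)

Section BasisExists.
Variables (k : fieldType) (n : nat) (P : truncOperad k n).
Hypothesis bd : forall l p, bounded_dim (P l p).
Variable D : nat.
Hypothesis big_zero : forall l p, (D < absz p)%N -> forall x : P l p, x = 0.

Let crds (l : 'I_n) (p : int) : coordinates (P l p) :=
  inhabited_witness (coordinates_exist (bd l p)).
Let dim l p := crd_dim (crds l p).
Let dg (j : 'I_(D + D).+1) : int := (j : nat)%:Z - D%:Z.

(** A triple: an arity, a degree between -D and D (shifted by D), and a coordinate
    of the piece they determine. *)
Definition basis_index : finType := {a : 'I_n * 'I_(D + D).+1 & 'I_(dim a.1 (dg a.2))}.

Let in_grade (l : 'I_n) (p : int) (t : basis_index) : bool :=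
  ((tag t).1 == l) && (dg (tag t).2 == p).
Let idx (t : basis_index) : nat := tagged t.

(** The coordinate is compared as a natural number, because the pieces of [t] and of
    (l, p) agree only up to the equations in [in_grade]. *)
Definition index_vec (l : 'I_n) (p : int) (t : basis_index) : P l p :=
  if in_grade l p t then crd_inv (crds l p) (\row_i (i == idx t :> nat)%:R) else 0.

Definition index_coord (l : 'I_n) (p : int) (v : P l p) (t : basis_index) : k :=
  if in_grade l p t then \sum_(i < dim l p | i == idx t :> nat) crd (crds l p) v 0 i
  else 0.

Lemma dg_inj : injective dg.
Proof. by move=> i j /addIr[] /val_inj. Qed.

Lemma dg_surj p : (absz p <= D)%N -> exists j, dg j = p.
Proof.
move=> pD; have jD : (absz (p + D%:Z)%R < (D + D).+1)%N by lia.
by exists (Ordinal jD); rewrite /dg /=; lia.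
Qed.

Lemma index_expand l p (v : P l p) : v = \sum_t index_coord v t *: index_vec l p t.
Proof.
have [pD|/big_zero z] := leqP (absz p) D; last by rewrite [LHS]z [RHS]z.
have [j Ej] := dg_surj pD; subst p.
pose F (a : 'I_n * 'I_(D + D).+1) (i : 'I_(dim a.1 (dg a.2))) :=
  index_coord v (Tagged (fun a => 'I_(dim a.1 (dg a.2))) i) *:
  index_vec l (dg j) (Tagged (fun a => 'I_(dim a.1 (dg a.2))) i).
transitivity (\sum_a \sum_i F a i); last first.
  rewrite (sig_big_dep (J := fun a : 'I_n * 'I_(D + D).+1 => 'I_(dim a.1 (dg a.2)))
    xpredT (fun _ => xpredT) F) /=.
  by apply: eq_bigr => -[a i] _.
rewrite (bigD1 (l, j)) //= [X in _ + X]big1 ?addr0 => [|a na]; last first.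
  apply: big1 => i _; rewrite /F /index_coord; case: ifP; last by rewrite scale0r.
  rewrite /in_grade /= => /andP[/eqP E1 /eqP/dg_inj E2].
  by rewrite -E1 -E2 -surjective_pairing eqxx in na.
have li := crd_inv_linear (crds l (dg j)).
rewrite -[LHS](crdK (crds l (dg j))) [crd _ v]row_sum_delta.
rewrite (lin_sum _ _ li); apply: eq_bigr => i _.
rewrite /F /index_coord /index_vec /in_grade /= !eqxx /=.
congr (_ *: _).
  by rewrite (big_pred1 i) // => i'; rewrite /idx /= val_eqE.
congr (crd_inv _).
by apply/rowP => i'; rewrite !mxE eqxx /= val_eqE.
Qed.

Lemma index_coord_vec l p t s :
  index_coord (index_vec l p t) s = (in_grade l p t && (s == t))%:R.
Proof.
rewrite /index_coord /index_vec.
have [gs|/negbTE ngs] := boolP (in_grade l p s); last first.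
  by have [E|] := eqVneq s t; [rewrite -E ngs | rewrite andbF].
have [gt|_] := boolP (in_grade l p t); last first.
  by rewrite (lin0 (crd_linear _)); apply: big1 => i _; rewrite mxE.
rewrite crd_invK.
case: s t gs gt => [[a i] x] [[a' i'] x']; rewrite /in_grade /idx /=.
move=> /andP[/eqP Ea /eqP Ei] /andP[/eqP Ea' /eqP Ei']; subst l p; subst a'.
move/dg_inj: Ei' => E; subst i'.
rewrite eq_Tagged /= (big_pred1 x) => [|z]; last by rewrite val_eqE.
by rewrite mxE.
Qed.

Lemma index_coord_linear l p a (v w : P l p) t :
  index_coord (a *: v + w) t = a * index_coord v t + index_coord w t.
Proof.
rewrite /index_coord; case: ifP => _; last by rewrite mulr0 addr0.
rewrite (crd_linear _) mulr_sumr -big_split; apply: eq_bigr => i _ /=.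
by rewrite !mxE.
Qed.

Lemma graded_basis_exists : exists N, inhabited (graded_basis P N).
Proof.
exists #|basis_index|; constructor.
pose co l p (v : P l p) : 'cV[k]_#|basis_index| :=
  \col_x index_coord v (enum_val x).
have lco l p : linear (@co l p).
  by move=> a v w; apply/colP => x; rewrite !mxE index_coord_linear.
have ex l p (v : P l p) :
    v = \sum_x co l p v x 0 *: index_vec l p (enum_val x).
  rewrite {1}[v]index_expand (reindex (@enum_val basis_index predT)) /=; last first.
    exact/onW_bij/enum_val_bij.
  by apply: eq_bigr => x _; rewrite mxE.
apply: (@GradedBasis k n P _ (fun x => (tag (enum_val x)).1)
  (fun x => dg (tag (enum_val x)).2) (fun l p x => index_vec l p (enum_val x)) co
  lco ex) => l p x.
apply/colP => y; rewrite mxE index_coord_vec -/(in_grade l p (enum_val x)).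
rewrite (inj_eq enum_val_inj).
by case: (in_grade l p _); rewrite /= mxE ?andbT.
Qed.

End BasisExists.

(** * The automorphism group schemes of P and HP *)

(** The equations are written with the structure constants of P; over A they
    become the ones of P (x) A, to which [aut_mxP] applies. *)
Lemma matrix_presentation (k : fieldType) (n : nat) (P : truncOperad k n) (N : nat)
    (b : graded_basis P N) :
  let eqs := structure_equations (unary_constants b) (binary_constants b) in
  let eta (A : kAlg k) (f : AutF P A) := aut_mx (ext_basis b A) f in
  [/\ matrix_group_iso (A := base_alg k) eqs (aut_mx b),
      forall A : kAlg k, matrix_group_iso eqs (eta A),
      forall (A B : kAlg k) (g : algHom A B) (f : AutF P A),
        eta B (gf_map g f) = map_mx g (eta A f)
    & forall f : operad_aut P,
        eta (base_alg k) (aut_ext (base_alg k) f) = aut_mx b f].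
Proof.
move=> eqs eta; split.
- split; [exact: aut_mx_inj | exact: aut_mxM | move=> g].
  rewrite -aut_mxP; apply: and_iff_compat_l; rewrite structure_equationsP.
  suff [-> ->] : (fun u => map_mx (alg_str (base_alg k)) (unary_constants b u))
      = unary_constants b /\
    (fun w x y => map_mx (alg_str (base_alg k)) (binary_constants b w x y))
      = binary_constants b by [].
  split; do ?[apply: functional_extensionality_dep => ?];
  by apply/matrixP => i j; rewrite mxE.
- move=> A; split; [exact: aut_mx_inj | exact: aut_mxM | move=> g].
  rewrite -aut_mxP; apply: and_iff_compat_l; rewrite structure_equationsP.
  suff [-> ->] : (fun u => map_mx (alg_str A) (unary_constants b u))
      = unary_constants (ext_basis b A) /\
    (fun w x y => map_mx (alg_str A) (binary_constants b w x y))
      = binary_constants (ext_basis b A) by [].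
  split; do ?[apply: functional_extensionality_dep => ?].
    by rewrite ext_unary_constants.
  by rewrite ext_binary_constants.
- move=> A B g f; apply/matrixP => z x; rewrite !mxE /=.
  have lf := mor_linear (aut_mor (f : operad_aut _)).
  by rewrite (ext_bcE g (lf _ _)) scale1r ext_coord_mor mxE.
- move=> f; apply/matrixP => z x; rewrite !mxE /=.
  have lf := mor_linear (aut_mor f).
  by rewrite (ext_mapE (lf _ _)) ext_coordE scale1r mxE.
Qed.

Lemma aut_functor_algebraic (k : fieldType) (n : nat) (P : truncOperad k n) (N : nat)
    (b : graded_basis P N) : algebraic_affine_group_scheme (AutF P).
Proof.
have [_ iso nat _] := matrix_presentation b.
exact: matrix_group_functor_algebraic iso nat.
Qed.

Theorem proposition6p1p2 (k : fieldType) (n : nat) (P : truncOperad k n) :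
  [pchar k] =i pred0 -> (0 < n)%N -> finite_type P ->
  (exists (N : nat) (eqs : seq {mpoly k[N * N]}) (rho : operad_aut P -> 'M[k]_N),
     (* (1) *)
     matrix_group_iso (A := base_alg k) eqs rho /\
     (* (2) *)
     algebraic_affine_group_scheme (AutF P) /\
     exists eta : forall A : kAlg k, AutF P A -> 'M[A]_N,
       [/\ forall A : kAlg k, matrix_group_iso eqs (eta A),
           forall (A B : kAlg k) (g : algHom A B) (f : AutF P A),
             eta B (gf_map g f) = map_mx g (eta A f)
         & forall f : operad_aut P,
             eta (base_alg k) (aut_ext (base_alg k) f) = rho f]) /\
  (* (3) *)
  algebraic_affine_group_scheme (AutF (homology_operad P)) /\
  (exists H : groupFunctorMor (AutF P) (AutF (homology_operad P)),
     induced_on_homology H /\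
     forall H' : groupFunctorMor (AutF P) (AutF (homology_operad P)),
       induced_on_homology H' ->
       forall (A : kAlg k) (f : AutF P A), H' A f = H A f).
Proof.
move=> _ _ fin.
have bd l p : bounded_dim (P l p).
  by have [fd _] := fin l; exact/finite_dim_bounded/fd.
have [D big_zero] : exists D, forall l p, (D < absz p)%N -> forall x : P l p, x = 0.
  have [Dl DlP] := choice (fun l => (fin l).2).
  exists (\max_l Dl l) => l p lt; apply: DlP; apply: leq_ltn_trans lt.
  exact: leq_bigmax.
have [N [b]] := graded_basis_exists bd big_zero.
have [N' [b']] : exists N', inhabited (graded_basis (homology_operad P) N').
  apply: (@graded_basis_exists _ _ _ _ D) => [l p|l p lt x].
    exact: bounded_dim_homology (bd l p).
  have [z _ ->] := hclP x; rewrite [z](big_zero _ _ lt); exact: hcl0.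
have kinj (A : kAlg k) l p : injective (@kunneth k n P A l p).
  have [h lh hK] := generalized_inverse (bd l p) (bd l (p - 1))
    (cx_d_linear (deg_pred p)).
  exact: kunneth_injective lh hK.
have ksurj (A : kAlg k) l p y : exists x, @kunneth k n P A l p x = y.
  have [h lh hK] := generalized_inverse (bd l p) (bd l (p - 1))
    (cx_d_linear (deg_pred p)).
  exact: kunneth_surjective lh hK y.
split; last split.
- have [iso1 iso2 nat base] := matrix_presentation b.
  exists N, (structure_equations (unary_constants b) (binary_constants b)), (aut_mx b).
  split=> //; split; first exact: aut_functor_algebraic b.
  by exists (fun A f => aut_mx (ext_basis b A) f).
- exact: aut_functor_algebraic b'.
- exists (homology_functor_mor kinj ksurj).
  have iH := homology_functor_mor_induced kinj ksurj.
  by split=> // H' iH'; exact: induced_on_homology_unique.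
Qed.
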